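(* The class of functionals represented by closed terms of $\lambda(\mathsf{MPT})$ equals the class $\mathsf{BFF}$ of basic feasible functionals, i.e. the class of functionals represented by closed terms of $\lambda(\mathsf{FP}\cup\{\mathcal R\})$.
   Context: Strings over $\Sigma=\{0,1\}$; $\mathcal B$ = functions $\Sigma^*\to\Sigma^*$; an operator $F\colon\mathcal B\to\mathcal B$ is identified with the type-two functional $(\varphi,\mathbf a)\mapsto F(\varphi)(\mathbf a)$. $\mathsf{MPT}$: operators computed by an oracle machine (oracle call costs one step) having a polynomial step-count (a polynomial $p$ with running time on $\varphi,\mathbf a$ at most $p(m_{\varphi,\mathbf a})$, where $m_{\varphi,\mathbf a}$ is the max of $|\mathbf a|$ and all oracle-answer lengths in the run) and finite lookahead revision (some $r$ such that in every run at most $r$ times a query longer than all previous queries is posed). $\mathsf{FP}$: polynomial-time computable string functions. Simple types: $0$ (strings) and $\sigma\to\tau$; $\lambda(X)$: simply-typed $\lambda$-terms with variables of all types, a constant for each functional in $X$, abstraction and application, interpreted in the full set-theoretic type structure. $\mathcal R(\varphi,\mathbf a,\mathbf b,\epsilon)=\mathbf a$, $\mathcal R(\varphi,\mathbf a,\mathbf b,\mathbf ci)=\varphi(\mathbf ci,\mathcal R(\varphi,\mathbf a,\mathbf b,\mathbf c))^{\le|\mathbf b|}$, where $\mathbf x^{\le n}$ truncates to the first $n$ symbols. *)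

(* Defs.v *)
From mathcomp Require Import all_boot all_order all_algebra.

Set Implicit Arguments.
Unset Strict Implicit.
Unset Printing Implicit Defensive.

Definition str := seq bool.

(** * Oracle Turing machines *)

(* [None] is the blank. *)
Definition symbol := option bool.

Inductive move := MoveLeft | Stay | MoveRight.

(* A two-way infinite tape [(l, r)]: [l] lists the cells to the left of the head,
   nearest first, and [r] lists the scanned cell followed by the cells to its
   right; all the cells that are not listed are blank. *)
Definition tape := (seq symbol * seq symbol)%type.

Definition scan (T : tape) : symbol := head None T.2.

Definition act (w : symbol * move) (T : tape) : tape :=
  let l := T.1 in
  let r := w.1 :: behead T.2 in
  match w.2 with
  | MoveLeft => (behead l, head None l :: r)
  | Stay => (l, r)
  | MoveRight => (head None r :: l, behead r)
  end.

Definition blank_tape : tape := ([::], [::]).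

Definition tape_of_str (a : str) : tape := ([::], map Some a).

Fixpoint blank_free_prefix (r : seq symbol) : str :=
  if r is Some b :: r' then b :: blank_free_prefix r' else [::].

(* The string on a tape extends from the scanned cell to the first blank. *)
Definition str_of_tape (T : tape) : str := blank_free_prefix T.2.

(* Deterministic multi-tape oracle machines with [k] input strings. If
   [ask q = Some q'], then in state [q] the machine poses the string on its query
   tape to the oracle and goes on in state [q'], and [trans q] is irrelevant. The
   designated tapes may coincide, except for the input tapes. *)
Record machine (k : nat) := Machine {
  state : finType;
  tape_name : finType;
  start : state;
  halting : pred state;
  ask : state -> option state;
  trans : state -> {ffun tape_name -> symbol} ->
          state * {ffun tape_name -> symbol * move};
  input_tape : 'I_k -> tape_name;
  input_tape_inj : injective input_tape;
  output_tape : tape_name;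
  query_tape : tape_name;
  answer_tape : tape_name }.

Section Runs.

Variables (k : nat) (M : machine k) (phi : str -> str) (a : k.-tuple str).

Definition config := (state M * {ffun tape_name M -> tape})%type.

Definition initial : config :=
  (start M,
   [ffun t => if [pick i | input_tape M i == t] is Some i
              then tape_of_str (tnth a i) else blank_tape]).

Definition halted (c : config) : bool := halting c.1.

Definition posed (c : config) : option str :=
  if halted c then None
  else if ask c.1 is Some _ then Some (str_of_tape (c.2 (query_tape M)))
  else None.

(* Every step costs one unit, and so does an oracle call; it replaces the contents
   of the answer tape by the answer, with the head on its first symbol. *)
Definition step (c : config) : config :=
  if halted c then c
  else if ask c.1 is Some q then
    (q, [ffun t => if t == answer_tape M
                   then tape_of_str (phi (str_of_tape (c.2 (query_tape M))))
                   else c.2 t])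
  else
    let qw := trans c.1 [ffun t => scan (c.2 t)] in
    (qw.1, [ffun t => act (qw.2 t) (c.2 t)]).

Definition run (n : nat) : config := iter n step initial.

Definition runtime (n : nat) : Prop :=
  halted (run n) /\ forall i, i < n -> ~~ halted (run i).

Definition result (n : nat) : str := str_of_tape ((run n).2 (output_tape M)).

(* The queries posed in the first [n] steps, in chronological order. *)
Definition queries (n : nat) : seq str :=
  pmap (fun i => posed (run i)) (iota 0 n).

(* For [n] the running time, this is the number m_{phi,a}. *)
Definition max_length (n : nat) : nat :=
  maxn (\max_(x <- a) size x) (\max_(q <- queries n) size (phi q)).

End Runs.

Definition computes (k : nat) (M : machine k)
    (F : (str -> str) -> k.-tuple str -> str) : Prop :=
  forall phi a, exists2 n, runtime M phi a n & result M phi a n = F phi a.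

Definition polynomial_step_count (k : nat) (M : machine k) : Prop :=
  exists p : {poly nat}, forall phi a,
    exists2 n, runtime M phi a n & n <= p.[max_length M phi a n]%R.

Definition lookahead_revisions (qs : seq str) : nat :=
  count (fun i => all (fun q => size q < size (nth [::] qs i)) (take i qs))
        (iota 0 (size qs)).

Definition finite_lookahead_revision (k : nat) (M : machine k) : Prop :=
  exists r : nat, forall phi a n,
    lookahead_revisions (queries M phi a n) <= r.

Definition MPT (F : (str -> str) -> (str -> str)) : Prop :=
  exists M : machine 1,
    [/\ computes M (fun phi a => F phi (thead a)),
        polynomial_step_count M & finite_lookahead_revision M].

(* An ordinary Turing machine is an oracle machine without query states; then
   [max_length] is the maximal length of the inputs. *)
Definition oracle_free (k : nat) (M : machine k) : Prop :=
  forall q : state M, ask q = None.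

Definition polytime (k : nat) (f : k.-tuple str -> str) : Prop :=
  exists M : machine k,
    [/\ oracle_free M, computes M (fun _ => f) & polynomial_step_count M].

(** * Simply typed lambda-terms over a class of functionals *)

Inductive ty := Str | Arr (s t : ty).

Fixpoint den (s : ty) : Type :=
  match s with
  | Str => str
  | Arr s t => den s -> den t
  end.

Definition functional_class := forall s : ty, den s -> Prop.

Definition class_union (X Y : functional_class) : functional_class :=
  fun s f => X s f \/ Y s f.

(* Typed de Bruijn indices: [var G s] is the type of the positions of [s] in [G]. *)
Inductive var : seq ty -> ty -> Type :=
| VarO G s : var (s :: G) s
| VarS G s t : var G s -> var (t :: G) s.

Inductive term (X : functional_class) : seq ty -> ty -> Type :=
| Var G s : var G s -> term X G s
| Const G s (f : den s) : X s f -> term X G s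
| Lam G s t : term X (s :: G) t -> term X G (Arr s t)
| App G s t : term X G (Arr s t) -> term X G s -> term X G t.

Fixpoint env (G : seq ty) : Type :=
  if G is s :: G' then (den s * env G')%type else unit.

Fixpoint lookup G s (x : var G s) : env G -> den s :=
  match x in var G s return env G -> den s with
  | VarO _ _ => fun e => e.1
  | VarS _ _ _ y => fun e => lookup y e.2
  end.

Fixpoint eval X G s (u : term X G s) : env G -> den s :=
  match u in term _ G s return env G -> den s with
  | Var _ _ x => lookup x
  | Const _ _ f _ => fun _ => f
  | Lam _ _ _ v => fun e x => eval v (x, e)
  | App _ _ _ v w => fun e => eval v e (eval w e)
  end.

Definition represented (X : functional_class) : functional_class :=
  fun s f => exists u : term X [::] s, eval u tt = f.

(** * The classes of functionals *)

Inductive MPT_class : functional_class :=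
| MPT_intro (F : (str -> str) -> (str -> str)) :
    MPT F -> @MPT_class (Arr (Arr Str Str) (Arr Str Str)) F.

Fixpoint str_fun (k : nat) : ty :=
  if k is k'.+1 then Arr Str (str_fun k') else Str.

Fixpoint uncurry_str (k : nat) : den (str_fun k) -> k.-tuple str -> str :=
  match k return den (str_fun k) -> k.-tuple str -> str with
  | 0 => fun f _ => f
  | k'.+1 => fun f a => uncurry_str (f (thead a)) (behead_tuple a)
  end.

(* String functions of any arity at least one. Arity zero has to be left out: it
   would provide closed terms of type [Str], whereas no closed term over
   [MPT_class] has that type. *)
Inductive FP_class : functional_class :=
| FP_intro (k : nat) (f : den (str_fun k.+1)) :
    polytime (uncurry_str f) -> @FP_class (str_fun k.+1) f.

(* [limited_rec_rev phi a b s] is R(phi, a, b, c) for c the reversal of [s]: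
   strings are extended on the right, so that the recursion removes the last
   symbol of c. *)
Fixpoint limited_rec_rev (phi : str -> str -> str) (a b s : str) : str :=
  if s is i :: s' then
    take (size b) (phi (rev s) (limited_rec_rev phi a b s'))
  else a.

Definition limited_rec (phi : str -> str -> str) (a b c : str) : str :=
  limited_rec_rev phi a b (rev c).

Lemma limited_rec_nil phi a b : limited_rec phi a b [::] = a.
Proof. by []. Qed.

Lemma limited_rec_rcons phi a b c i :
  limited_rec phi a b (rcons c i) =
  take (size b) (phi (rcons c i) (limited_rec phi a b c)).
Proof. by rewrite /limited_rec rev_rcons /= rev_cons revK. Qed.

Inductive R_class : functional_class :=
| R_intro :
    @R_class (Arr (Arr Str (Arr Str Str)) (Arr Str (Arr Str (Arr Str Str))))
             limited_rec.

Definition BFF : functional_class :=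
  represented (class_union FP_class R_class).

(* Main.v *)
Require Import Defs.
From Stdlib Require Import FunctionalExtensionality.
From mathcomp Require Import all_boot all_order all_algebra zify.

(** From MPT to limited recursion. If the oracle is changed to answer the empty
    string outside the queries posed so far, the run has to stop; hence t steps of
    a run take at most p(m_t) steps, for m_t the maximal length known at time t.
    Simulating p(m) steps thus either settles the run or finds a query with an
    answer longer than m. Between two lookahead revisions all queries have length
    at most some known L. The search for longer and longer answers is organised as
    a doubly nested limited recursion on queries: the inner one makes |phi(q)| + 1
    improvements starting from q, so each round of the outer one doubles the number
    of improvements, and linearly many rounds in L exhaust the strings of length at
    most L. One such search for each of the boundedly many lookahead revisions
    yields a clock for the whole run. The polynomial-time part is a function that
    runs the machine against a transcript of answers, while limited recursion
    builds up the transcript.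

    From limited recursion to MPT. The pairing (a, b) is F(phi)(a) for an F in MPT
    that poses one query, with phi constantly b; this reduces functions of several
    strings to unary ones. R comes from a machine that first poses its whole
    input, which is longer than all its later queries.

    The machines are obtained from structured programs on stacks of bits. *)

Set Implicit Arguments.
Unset Strict Implicit.
Unset Printing Implicit Defensive.

Notation funext := functional_extensionality.

(** * A structured language of stack programs *)

Inductive op := Keep | Pop | Put of bool | Push of bool | PutPush of bool & bool.

Definition ap (o : op) (s : str) : str :=
  match o with
  | Keep => s
  | Pop => behead s
  | Put b => b :: behead s
  | Push b => b :: s
  | PutPush b b' => b' :: b :: behead s
  end.

(* Every operation takes two machine steps: [op_first] and then the writing of
   [op_pending], if any. *)
Definition op_first (o : op) (x : symbol) : symbol * move :=
  match o with
  | Keep => (x, Stay)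
  | Pop => (None, MoveRight)
  | Put b => (Some b, Stay)
  | Push _ => (x, MoveLeft)
  | PutPush b _ => (Some b, MoveLeft)
  end.

Definition op_pending (o : op) : option bool :=
  match o with
  | Push b => Some b
  | PutPush _ b => Some b
  | _ => None
  end.

Definition holds (T : tape) (s : str) : Prop :=
  exists k, T.2 = map Some s ++ nseq k None.

Lemma holds_str T s : holds T s -> str_of_tape T = s.
Proof.
case=> k; rewrite /str_of_tape => ->.
by elim: s => [|b s IH] /=; [case: k | rewrite IH].
Qed.

Lemma holds_scan T s : holds T s -> scan T = ohead s.
Proof. by case=> k; rewrite /scan => ->; case: s => //; case: k. Qed.

Lemma holds_tape_of_str s : holds (tape_of_str s) s.
Proof. by exists 0; rewrite cats0. Qed.

(** The inner [act] is the first machine step of the operation. The outer one writes the pending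
    bit, or rewrites the scanned symbol if none is pending. *)
Lemma holds_op T s o : holds T s ->
  holds (act (if op_pending o is Some b then Some b
              else scan (act (op_first o (scan T)) T), Stay)
             (act (op_first o (scan T)) T)) (ap o s).
Proof.
move=> hT; have hs := holds_scan hT.
case: T hT hs => l r [k /= ->] ->.
case: s => [|x s]; case: o => [||b|b|b b'] /=.
- by case: k => [|k]; [exists 1 | exists k.+1].
- by case: k => [|[|k]]; [exists 1|exists 1|exists k.+1].
- by exists k.-1; case: k.
- by exists k.-1.+1; case: k.
- by exists k.-1; case: k.
- by exists k.
- case: s => [|y s]; last by exists k.
  by case: k => [|k] /=; [exists 1|exists k.+1].
- by exists k.
- by exists k.
- by exists k.
Qed.

Section Language.

Variables (F I : finType) (qi ai : I).

Inductive cmd :=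
| Prim of (F -> (I -> symbol) -> F * (I -> op))
| Ask
| Seq of cmd & cmd
| If of (F -> (I -> symbol) -> bool) & cmd & cmd
| While of (F -> (I -> symbol) -> bool) & cmd.

(** Control points form a finite type computed from the program, so the compiled machine has
    finitely many states. In a primitive, [Some w] stores the writes pending for the second step; in
    a conditional or a loop, [None] is the test. *)
Fixpoint pc (c : cmd) : finType :=
  match c with
  | Prim _ => option {ffun I -> option bool}
  | Ask => unit
  | Seq c d => (pc c + pc d)%type
  | If _ c d => option (pc c + pc d)%type
  | While _ c => option (pc c)
  end.

Fixpoint entry (c : cmd) : pc c :=
  match c return pc c with
  | Prim _ => None
  | Ask => tt
  | Seq c _ => inl (entry c)
  | If _ _ _ => None
  | While _ _ => None
  end.

Definition outcome (P : Type) := (option P * F * (I -> symbol * move))%type.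

Definition rename_pc P Q (h : option P -> option Q) (x : outcome P) : outcome Q :=
  (h x.1.1, x.1.2, x.2).

Definition idle (t : I -> symbol) : I -> symbol * move := fun i => (t i, Stay).

Definition emb_seql c d (p : option (pc c)) : option (pc (Seq c d)) :=
  if p is Some p then Some (inl p) else Some (inr (entry d)).
Definition emb_seqr c d (p : option (pc d)) : option (pc (Seq c d)) :=
  if p is Some p then Some (inr p) else None.
Definition emb_ifl t c d (p : option (pc c)) : option (pc (If t c d)) :=
  if p is Some p then Some (Some (inl p)) else None.
Definition emb_ifr t c d (p : option (pc d)) : option (pc (If t c d)) :=
  if p is Some p then Some (Some (inr p)) else None.
(** Leaving the body is [None], which here becomes [Some None]: control returns to the test of the
    loop. *)
Definition emb_while t c (p : option (pc c)) : option (pc (While t c)) := Some p.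

Fixpoint next_pc (c : cmd) : pc c -> F -> (I -> symbol) -> outcome (pc c) :=
  match c return pc c -> F -> (I -> symbol) -> outcome (pc c) with
  | Prim f => fun p m t =>
      if p is Some w then
        (None, m, fun i => (if w i is Some b then Some b else t i, Stay))
      else
        let r := f m t in
        (Some (Some [ffun i => op_pending (r.2 i)]), r.1,
         fun i => op_first (r.2 i) (t i))
  | Ask => fun _ m t => (None, m, idle t)
  | Seq c d => fun p m t =>
      match p with
      | inl p => rename_pc (@emb_seql c d) (next_pc p m t)
      | inr p => rename_pc (@emb_seqr c d) (next_pc p m t)
      end
  | If b c d => fun p m t =>
      match p with
      | None => (Some (Some (if b m t then inl (entry c) else inr (entry d))), m,
                 idle t)
      | Some (inl p) => rename_pc (@emb_ifl b c d) (next_pc p m t)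
      | Some (inr p) => rename_pc (@emb_ifr b c d) (next_pc p m t)
      end
  | While b c => fun p m t =>
      match p with
      | None => (if b m t then Some (Some (entry c)) else None, m, idle t)
      | Some p => rename_pc (@emb_while b c) (next_pc p m t)
      end
  end.

Fixpoint ask_pc (c : cmd) : pc c -> option (option (pc c)) :=
  match c return pc c -> option (option (pc c)) with
  | Prim _ => fun _ => None
  | Ask => fun _ => Some None
  | Seq c d => fun p =>
      match p with
      | inl p => omap (@emb_seql c d) (ask_pc p)
      | inr p => omap (@emb_seqr c d) (ask_pc p)
      end
  | If b c d => fun p =>
      match p with
      | None => None
      | Some (inl p) => omap (@emb_ifl b c d) (ask_pc p)
      | Some (inr p) => omap (@emb_ifr b c d) (ask_pc p)
      end
  | While b c => fun p =>
      if p is Some p then omap (@emb_while b c) (ask_pc p) else None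
  end.

Fixpoint ask_free (c : cmd) : bool :=
  match c with
  | Prim _ => true
  | Ask => false
  | Seq c d => ask_free c && ask_free d
  | If _ c d => ask_free c && ask_free d
  | While _ c => ask_free c
  end.

Lemma ask_free_pc c (p : pc c) : ask_free c -> ask_pc p = None.
Proof.
elim: c p => [f||c IHc d IHd|b c IHc d IHd|b c IHc] p //=.
- by case: p => p /andP[hc hd]; rewrite ?IHc ?IHd.
- by case: p => [[] p|] // /andP[hc hd]; rewrite ?IHc ?IHd.
- by case: p => [p|] // hc; rewrite IHc.
Qed.

Section Execution.

Variable phi : str -> str.

Definition upd (A : Type) (s : I -> A) (i : I) (x : A) : I -> A :=
  fun j => if j == i then x else s j.

Definition pstate (c : cmd) := (option (pc c) * F * (I -> tape))%type.

Definition cstep c (p : pc c) (m : F) (T : I -> tape) : pstate c :=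
  if ask_pc p is Some p' then
    (p', m, upd T ai (tape_of_str (phi (str_of_tape (T qi)))))
  else
    let r := next_pc p m (fun i => scan (T i)) in
    (r.1.1, r.1.2, fun i => act (r.2 i) (T i)).

Definition emitted c (p : pc c) (T : I -> tape) : seq str :=
  if ask_pc p is Some _ then [:: str_of_tape (T qi)] else [::].

Inductive crun (c : cmd) : nat -> seq str -> pstate c -> pstate c -> Prop :=
| crun_nil x : crun 0 [::] x x
| crun_cons p m T n qs z :
    crun n qs (cstep p m T) z ->
    crun n.+1 (emitted p T ++ qs) (Some p, m, T) z.

Lemma crun_cat c n1 n2 qs1 qs2 (x y z : pstate c) :
  crun n1 qs1 x y -> crun n2 qs2 y z -> crun (n1 + n2) (qs1 ++ qs2) x z.
Proof.
move=> r1 r2; elim: n1 qs1 x y / r1 r2 => // p m T n qs y r IH r2.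
by rewrite addSn -catA; constructor; apply: IH.
Qed.

Definition emb_state c d (h : option (pc c) -> option (pc d)) (x : pstate c)
  : pstate d := (h x.1.1, x.1.2, x.2).

(** A run of a part is a run of the whole as soon as the embedding of control points commutes with
    asking and stepping. The map [h] also fixes where an exit of the part leads, so one lemma serves
    sequences, conditionals and loops. *)
Lemma crun_emb c d (h : option (pc c) -> option (pc d)) (g : pc c -> pc d) :
  (forall p, h (Some p) = Some (g p)) ->
  (forall p, ask_pc (g p) = omap h (ask_pc p)) ->
  (forall p m t, next_pc (g p) m t = rename_pc h (next_pc p m t)) ->
  forall n qs x y, crun n qs x y -> crun n qs (emb_state h x) (emb_state h y).
Proof.
move=> hS hA hN n qs x y r; elim: n qs x y / r => [x|p m T n qs z r IH].
  exact: crun_nil.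
rewrite {1}/emb_state /= hS.
have -> : emitted p T = emitted (g p) T.
  by rewrite /emitted hA; case: ask_pc.
apply: crun_cons; suff -> : cstep (g p) m T = emb_state h (cstep p m T) by [].
by rewrite /cstep hA hN; case: ask_pc.
Qed.

(* [exec c N qs x y]: from memory and stacks [x], [c] stops with [y] after at most
   [N] steps and poses the queries [qs]. *)
Definition exec c N qs (x y : F * (I -> str)) : Prop :=
  forall T, (forall i, holds (T i) (x.2 i)) ->
  exists n T', [/\ n <= N, crun n qs (Some (entry c), x.1, T) (None, y.1, T') &
                   forall i, holds (T' i) (y.2 i)].

Definition tops (s : I -> str) : I -> symbol := fun i => ohead (s i).

Lemma scan_tops T s :
  (forall i, holds (T i) (s i)) -> (fun i => scan (T i)) = tops s.
Proof. by move=> hT; apply: funext => i; apply: holds_scan. Qed.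

Lemma exec_le c N N' qs x y : N <= N' -> exec c N qs x y -> exec c N' qs x y.
Proof.
move=> hN hc T /hc [n [T' [hn r hT']]]; exists n, T'; split=> //.
exact: leq_trans hN.
Qed.

Lemma exec_prim f m s :
  exec (Prim f) 2 [::] (m, s)
       ((f m (tops s)).1, fun i => ap ((f m (tops s)).2 i) (s i)).
Proof.
move=> T hT /=; exists 2; eexists; split=> //.
  apply: (@crun_cons (Prim f) None _ _ 1 [::]).
  rewrite /cstep /= (scan_tops hT).
  apply: (@crun_cons (Prim f) (Some _) _ _ 0 [::]); exact: crun_nil.
move=> i; have := holds_op ((f m (tops s)).2 i) (hT i).
by rewrite /= ffunE (holds_scan (hT i)).
Qed.

Lemma exec_ask m s :
  exec Ask 1 [:: s qi] (m, s) (m, upd s ai (phi (s qi))).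
Proof.
move=> T hT /=; exists 1, (upd T ai (tape_of_str (phi (s qi)))); split=> //.
  have hq : str_of_tape (T qi) = s qi := holds_str (hT qi).
  rewrite -hq; by apply: (@crun_cons Ask tt _ _ 0 [::]); apply: crun_nil.
by move=> i; rewrite /upd; case: eqP => // _; apply: holds_tape_of_str.
Qed.

Lemma exec_seq c d N1 N2 qs1 qs2 x y z :
  exec c N1 qs1 x y -> exec d N2 qs2 y z ->
  exec (Seq c d) (N1 + N2) (qs1 ++ qs2) x z.
Proof.
move=> hc hd T /hc [n1 [T1 [hn1 r1 /hd [n2 [T2 [hn2 r2 hT2]]]]]].
exists (n1 + n2), T2; split=> //; first exact: leq_add.
apply: crun_cat.
  by apply: (@crun_emb _ _ (@emb_seql c d) inl _ _ _ _ _ _ _ r1).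
by apply: (@crun_emb _ _ (@emb_seqr c d) inr _ _ _ _ _ _ _ r2).
Qed.

Lemma holds_idle T s : (forall i, holds (T i) (s i)) ->
  forall i, holds (act (idle (fun i => scan (T i)) i) (T i)) (s i).
Proof. by move=> hT i; have := holds_op Keep (hT i). Qed.

Lemma exec_if b c d N qs x y :
  exec (if b x.1 (tops x.2) then c else d) N qs x y ->
  exec (If b c d) N.+1 qs x y.
Proof.
move=> h T hT.
have [] := h _ (holds_idle hT) => n [T' [hn r hT']].
exists n.+1, T'; split=> //.
apply: (@crun_cons (If b c d) None _ _ n qs).
rewrite /cstep /= (scan_tops hT) in r *.
move: h r; case: (b x.1 (tops x.2)) => _ r.
  by apply: (@crun_emb _ _ (@emb_ifl b c d) (fun p => Some (inl p)) _ _ _ _ _ _ _ r).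
by apply: (@crun_emb _ _ (@emb_ifr b c d) (fun p => Some (inr p)) _ _ _ _ _ _ _ r).
Qed.

Lemma exec_while0 (b : F -> (I -> symbol) -> bool) c x :
  ~~ b x.1 (tops x.2) -> exec (While b c) 1 [::] x x.
Proof.
move=> /negbTE hb T hT.
exists 1, (fun i => act (idle (fun j => scan (T j)) i) (T i)).
split=> //; last exact: (holds_idle hT).
apply: (@crun_cons (While b c) None _ _ 0 [::]).
by rewrite /cstep /= (scan_tops hT) hb; apply: crun_nil.
Qed.

Lemma exec_whileS (b : F -> (I -> symbol) -> bool) c N1 N2 qs1 qs2 x y z :
  b x.1 (tops x.2) -> exec c N1 qs1 x y -> exec (While b c) N2 qs2 y z ->
  exec (While b c) (1 + N1 + N2) (qs1 ++ qs2) x z.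
Proof.
move=> hb hc hw T hT.
have [n1 [T1 [hn1 r1 /hw [n2 [T2 [hn2 r2 hT2]]]]]] := hc _ (holds_idle hT).
exists (n1 + n2).+1, T2; split=> //.
  by rewrite -addnA ltnS leq_add.
apply: (@crun_cons (While b c) None _ _ (n1 + n2) (qs1 ++ qs2)).
rewrite /cstep /= (scan_tops hT) hb.
rewrite (scan_tops hT) in r1.
apply: crun_cat r2.
by apply: (@crun_emb _ _ (@emb_while b c) Some _ _ _ _ _ _ _ r1).
Qed.

End Execution.

End Language.

Arguments exec_le {F I qi ai phi c N N' qs x y} _ _.
Arguments exec_prim {F I qi ai phi} f m s.
Arguments exec_ask {F I qi ai phi} m s.
Arguments exec_seq {F I qi ai phi c d N1 N2 qs1 qs2 x y z} _ _.
Arguments exec_if {F I qi ai phi b c d N qs x y} _.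
Arguments exec_while0 {F I qi ai phi b c x} _.
Arguments exec_whileS {F I qi ai phi b c N1 N2 qs1 qs2 x y z} _ _ _.

(** * Prefixes of query lists, lookahead revisions and polynomial bounds *)

Section Queries.

Variables (k : nat) (M : machine k) (phi : str -> str) (a : k.-tuple str).

Lemma queriesS n : queries M phi a n.+1 =
  queries M phi a n ++ seq_of_opt (posed (run M phi a n)).
Proof. by rewrite /queries -addn1 iotaD pmap_cat /= /oapp; case: posed. Qed.

Lemma run_halted n n' : n <= n' -> halted (run M phi a n) ->
  run M phi a n' = run M phi a n.
Proof.
move=> /subnKC <- hn; elim: (n' - n) => [|j IH]; rewrite ?addn0 ?addnS //.
by rewrite /run iterS -/(run _ _ _ _) IH /step hn.
Qed.

Lemma queries_prefix n n' : n <= n' ->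
  exists qs, queries M phi a n' = queries M phi a n ++ qs.
Proof.
move=> /subnKC <-; elim: (n' - n) => [|j [qs IH]].
  by exists [::]; rewrite addn0 cats0.
by rewrite addnS queriesS IH -catA; eexists.
Qed.

Lemma queries_halted n n' : n <= n' -> halted (run M phi a n) ->
  queries M phi a n' = queries M phi a n.
Proof.
move=> /subnKC <- hn; elim: (n' - n) => [|j IH]; rewrite ?addn0 ?addnS //.
rewrite queriesS IH (run_halted _ hn) ?leq_addr //.
by rewrite /posed hn cats0.
Qed.

End Queries.

(** If the first query is a longest one, no later query is strictly longer than all its
    predecessors. This is how all the programs below get finite lookahead revision. *)
Lemma lookahead_le1 qs :
  {in qs, forall q, size q <= size (head [::] qs)} -> lookahead_revisions qs <= 1.
Proof.
case: qs => [|q qs] //= h; rewrite /lookahead_revisions /=.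
rewrite -[X in _ <= X]addn0 leq_add // leqn0 -leqn0 leqNgt -has_count.
apply/hasPn => i; rewrite mem_iota add1n ltnS => /andP[i1 i2].
case: i i1 i2 => // i _ i2 /=; rewrite negb_and -leqNgt.
by rewrite h // in_cons mem_nth ?orbT.
Qed.

Lemma leq_expn2r d m n : m <= n -> m ^ d <= n ^ d.
Proof. by case: d => // d h; rewrite leq_exp2r. Qed.

(** Together with the next lemma, this lets bounds of the form [C * n.+1 ^ d] replace polynomials
    everywhere else. Raising the exponent is multiplication by ['X + 1]. *)
Lemma poly_of_bound C d : exists p : {poly nat}, forall n, p.[n]%R = C * n.+1 ^ d.
Proof.
elim: d => [|d [p IH]].
  by exists (C%:P)%R => n; rewrite hornerC expn0 muln1.
exists (p * 'X + p)%R => n; rewrite hornerD hornerMX IH expnS.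
change (C * n.+1 ^ d * n + C * n.+1 ^ d = C * (n.+1 * n.+1 ^ d)); lia.
Qed.

Lemma bound_of_poly (p : {poly nat}) : exists C d, forall n, p.[n]%R <= C * n.+1 ^ d.
Proof.
elim/poly_ind: p => [|p c [C [d IH]]]; first by exists 0, 0 => n; rewrite horner0.
exists (C + c), d.+1 => n; rewrite hornerMXaddC.
change (p.[n]%R * n + c <= (C + c) * n.+1 ^ d.+1).
have h := IH n; have : 0 < n.+1 ^ d by rewrite expn_gt0.
move: (p.[n]%R) h => P; rewrite expnS; move: (n.+1 ^ d) => e; nia.
Qed.

(** * Compilation of programs to oracle machines *)

Section Compilation.

Variables (F I : finType) (qi ai : I) (c : cmd F I) (m0 : F).
Variables (k : nat) (l : seq I) (out : I).
Hypotheses (l_uniq : uniq l) (l_size : size l = k).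

Lemma nth_inj_inputs : injective (fun j : 'I_k => nth out l j).
Proof.
move=> i j /eqP; rewrite nth_uniq ?l_size // => /eqP h.
exact: val_inj.
Qed.

Definition compiled : machine k :=
  @Machine k (option (pc c) * F)%type I (Some (entry c), m0)
    (fun q => q.1 == None)
    (fun q => if q.1 is Some p then omap (fun p' => (p', q.2)) (ask_pc p) else None)
    (fun q r => if q.1 is Some p then
                  let x := next_pc p q.2 r in (x.1, [ffun i => x.2 i])
                else (q, [ffun i => (None, Stay)]))
    (fun j => nth out l j) nth_inj_inputs out qi ai.

(** A stack outside [l] has index [size l], so for a list [a] of that length the default value makes
    it empty. *)
Definition load_inputs (a : seq str) : I -> str := fun i => nth [::] a (index i l).

Definition compiled_config (x : pstate c) : config compiled :=
  (x.1, [ffun i => x.2 i]).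

(** The program and the machine agree step by step. A state that still has a control point is not
    halting, which excludes any halt before the end of the run. *)
Lemma crun_iter phi n qs x y : crun qi ai phi n qs x y ->
  let r i := iter i (@step k compiled phi) (compiled_config x) in
  [/\ r n = compiled_config y,
      forall i, i < n -> ~~ halted (r i) &
      pmap (fun i => posed (r i)) (iota 0 n) = qs].
Proof.
elim=> [//|p m T n' qs' z _ [IH1 IH2 IH3]] r.
have hr i : r i.+1 = iter i (@step k compiled phi) (compiled_config (cstep qi ai phi p m T)).
  rewrite /r iterSr; congr (iter _ _ _).
  rewrite /step /= /halted /= /cstep /=.
  case: (ask_pc p) => [p'|] /=.
    congr (_, _); apply/ffunP => i'; rewrite !ffunE /upd //=.
  have -> : [ffun t => scan ([ffun i' => T i'] t)] = [ffun t => scan (T t)].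
    by apply/ffunP => i'; rewrite !ffunE.
  have -> : ([ffun t => scan (T t)] : I -> symbol) = (fun t => scan (T t)).
    by apply: funext => i'; rewrite ffunE.
  congr (_, _); first by case: next_pc => [[]].
  by apply/ffunP => i'; rewrite !ffunE.
split; first by rewrite hr.
  by case=> [|i] // hi; rewrite hr IH2.
rewrite -[iota 0 n'.+1]/([:: 0] ++ iota (1 + 0) n') iotaDl pmap_cat -IH3; congr (_ ++ _).
  by rewrite /= /posed /= /halted /= /emitted; case: (ask_pc p) => //= p'; rewrite ffunE.
elim: (iota 0 n') => //= i s IHs.
by rewrite -hr IHs.
Qed.

Lemma compiled_run phi (a : k.-tuple str) N qs m s :
  exec qi ai phi c N qs (m0, load_inputs a) (m, s) ->
  exists n, [/\ runtime compiled phi a n, n <= N, result compiled phi a n = s out &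
                queries compiled phi a n = qs].
Proof.
pose T i : tape :=
  if [pick j : 'I_k | nth out l j == i] is Some j then tape_of_str (tnth a j)
  else blank_tape.
move=> /(_ T) [] /=.
  move=> i; rewrite /load_inputs /T; case: pickP => [j /eqP <-|h].
    by rewrite index_uniq ?l_size // (tnth_nth [::]); apply: holds_tape_of_str.
  rewrite nth_default; first by exists 0.
  rewrite size_tuple leqNgt -l_size index_mem; apply/negP => hi.
  have hi' : index i l < k by rewrite -l_size index_mem.
  by have := h (Ordinal hi'); rewrite /= nth_index ?eqxx.
move=> n [T' [hn /crun_iter [h1 h2 h3] hT']]; exists n.
have e : compiled_config (Some (entry c), m0, T) = initial compiled a by [].
rewrite e in h1 h2 h3; split=> //.
  by split=> //; rewrite /run h1.
by rewrite /result /run h1 /= ffunE; apply: holds_str.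
Qed.

End Compilation.

Lemma polytime_of_program (F I : finType) (c : cmd F I) (m0 : F) k (l : seq I)
    (out : I) (f : k.-tuple str -> str) C d :
  uniq l -> size l = k -> ask_free c ->
  (forall phi (a : k.-tuple str), exists N m s,
     [/\ exec out out phi c N [::] (m0, load_inputs l a) (m, s), s out = f a &
         N <= C * (\max_(x <- a) size x).+1 ^ d]) ->
  polytime f.
Proof.
move=> l_uniq l_size hc h; exists (compiled out out c m0 out l_uniq l_size); split.
- by case=> [[p|] m] //=; rewrite ask_free_pc.
- move=> phi a; have [N [m [s [/compiled_run h1 <- _]]]] := h phi a.
  by have [n [hn _ hr _]] := h1 out l_uniq l_size; exists n.
- have [p hp] := poly_of_bound C d; exists p => phi a.
  have [N [m [s [/compiled_run h1 _ hN]]]] := h phi a.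
  have [n [hn hle hr hq]] := h1 out l_uniq l_size; exists n => //.
  apply: leq_trans hle (leq_trans hN _).
  by rewrite hp /max_length hq big_nil maxn0.
Qed.

(** The time bound refers to the input alone, which [max_length] dominates; the condition on the
    queries yields a single lookahead revision. *)
Lemma MPT_of_program (F I : finType) (qi ai : I) (c : cmd F I) (m0 : F)
    (inp out : I) (G : (str -> str) -> str -> str) C d :
  (forall phi x, exists N qs m s,
     [/\ exec qi ai phi c N qs (m0, load_inputs [:: inp] [:: x]) (m, s),
         s out = G phi x, N <= C * (size x).+1 ^ d &
         {in qs, forall q, size q <= size (head [::] qs)}]) ->
  MPT G.
Proof.
move=> h; have l_uniq : uniq [:: inp] by [].
have l_size : size [:: inp] = 1 by [].
pose M := compiled qi ai c m0 out l_uniq l_size.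
have hM phi (a : 1.-tuple str) : exists n, [/\ runtime M phi a n,
     result M phi a n = G phi (thead a), n <= C * (size (thead a)).+1 ^ d &
     {in queries M phi a n,
       forall q, size q <= size (head [::] (queries M phi a n))}].
  have [N [qs [m [s [h1 h2 h3 h4]]]]] := h phi (thead a).
  have ea : [:: thead a] = a :> seq str by case: a {h h1 h2 h3} => [[|x []]].
  rewrite ea in h1.
  have [n [hn hle hr hq]] := compiled_run out l_uniq l_size h1.
  by exists n; split=> //; rewrite ?hr ?hq //; apply: leq_trans h3.
exists M; split.
- by move=> phi a; have [n [h1 h2 _ _]] := hM phi a; exists n.
- have [p hp] := poly_of_bound C d; exists p => phi a.
  have [n [h1 _ h2 _]] := hM phi a; exists n => //; apply: leq_trans h2 _.
  rewrite hp leq_mul2l leq_expn2r ?orbT // ltnS /max_length leq_max; apply/orP; left.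
  by case: a {h1} => [[|x []]] //= i; rewrite big_seq1.
- exists 1 => phi a n; have [n0 [[h1 _] _ _ h2]] := hM phi a.
  have [le|le] := leqP n n0; last first.
    by rewrite (queries_halted (ltnW le)) //; apply: lookahead_le1.
  (* A run that is cut off poses a prefix of the full list of queries; if nonempty, it starts with
     the same longest query. *)
  have [qs e] := queries_prefix M phi a le.
  apply: lookahead_le1 => q hq; have := h2 q; rewrite e mem_cat hq => /(_ isT).
  by case: (queries _ _ _ n) hq.
Qed.

(** * Pairing of strings *)

Definition mark (s : str) : str := flatten [seq [:: true; b] | b <- s].

(** Each bit of the first component follows a flag [true], and [false] ends it. The component is
    reversed because decoding pushes its bits one by one onto a stack, which restores the order. *)
Definition pair_str (a b : str) : str := mark (rev a) ++ false :: b.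

Fixpoint unpair (acc z : str) : str * str :=
  match z with
  | true :: b :: z' => unpair (b :: acc) z'
  | [:: true] => (acc, [::])
  | false :: z' => (acc, z')
  | [::] => (acc, [::])
  end.

Lemma unpair_mark acc u z : unpair acc (mark u ++ false :: z) = (rev u ++ acc, z).
Proof.
elim: u acc => [//|b u IH] acc /=.
by rewrite IH rev_cons cat_rcons.
Qed.

Lemma unpair_pair a b : unpair [::] (pair_str a b) = (a, b).
Proof. by rewrite /pair_str unpair_mark revK cats0. Qed.

Lemma size_mark s : size (mark s) = (size s).*2.
Proof. by elim: s => //= b s ->. Qed.

Lemma mark_cat s t : mark (s ++ t) = mark s ++ mark t.
Proof. by rewrite /mark map_cat flatten_cat. Qed.

(** Every decoded bit uses up two symbols. The induction is on the length, as two symbols are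
    removed at a time. *)
Lemma size_unpair acc z :
  (size (unpair acc z).1).*2 + size (unpair acc z).2 <= (size acc).*2 + size z.
Proof.
have [n] := ubnP (size z); elim: n acc z => // n IH acc [|[] [|b z]] //=; try lia.
  rewrite !ltnS => h; have := IH (b :: acc) z (ltnW h) => /=; lia.
Qed.

(** * Elementary stack manipulations and their running times *)

Ltac upd_val :=
  rewrite /upd;
  repeat match goal with H : is_true (?a != ?b) |- _ => apply (elimN eqP) in H end;
  repeat (case: eqP => ?); try congruence.
Ltac upd_tac := apply: funext => ?; upd_val.

Section Macros.

Variables (F I : finType) (qi ai : I) (phi : str -> str).
Implicit Types (s : I -> str) (m : F) (i j : I).

Definition push1 i b : cmd F I :=
  Prim (fun m _ => (m, fun j => if j == i then Push b else Keep)).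
Definition pop1 i : cmd F I :=
  Prim (fun m _ => (m, fun j => if j == i then Pop else Keep)).
Definition mv i j : cmd F I :=
  Prim (fun m t => (m, fun h => if h == i then Pop else if h == j then
                        (if t i is Some b then Push b else Keep) else Keep)).

Definition nonempty i : F -> (I -> symbol) -> bool := fun _ t => t i != None.

Definition drain i j : cmd F I := While (nonempty i) (mv i j).
Definition clear i : cmd F I := While (nonempty i) (pop1 i).
Definition unpair_into i j : cmd F I :=
  Seq (While (fun _ t => t i == Some true) (Seq (pop1 i) (mv i j))) (pop1 i).
Definition mark_into i j : cmd F I := While (nonempty i) (Seq (mv i j) (push1 j true)).
(** Each flag is pushed before its bit and so lies below it: the target receives the reversal of a
    marked string. Reversed transcripts are extended in this way. *)
Definition unmark_into i j : cmd F I :=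
  While (nonempty i) (Seq (push1 j true) (mv i j)).
Definition drain2 i i' j j' : cmd F I :=
  While (fun m t => nonempty i m t && nonempty j m t) (Seq (mv i i') (mv j j')).

Local Notation ex := (@exec F I qi ai phi).

Lemma exec_conv c N N' qs x y y' :
  ex c N qs x y -> N <= N' -> y = y' -> ex c N' qs x y'.
Proof. by move=> h hN <-; apply: exec_le hN h. Qed.
Arguments exec_conv {c N N' qs x y y'} _ _ _.

Lemma exec_push i b m s : ex (push1 i b) 2 [::] (m, s) (m, upd s i (b :: s i)).
Proof.
apply: exec_conv (exec_prim _ _ _) _ _ => //=.
by congr (_, _); apply: funext => j; rewrite /upd; case: eqP => // ->.
Qed.
Arguments exec_push i b m s : clear implicits.

Lemma exec_pop i m s : ex (pop1 i) 2 [::] (m, s) (m, upd s i (behead (s i))).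
Proof.
apply: exec_conv (exec_prim _ _ _) _ _ => //=.
by congr (_, _); apply: funext => j; rewrite /upd; case: eqP => // ->.
Qed.
Arguments exec_pop i m s : clear implicits.

Lemma exec_mv i j m s : i != j ->
  ex (mv i j) 2 [::] (m, s)
     (m, upd (upd s i (behead (s i))) j (seq_of_opt (ohead (s i)) ++ s j)).
Proof.
move=> ij; apply: exec_conv (exec_prim _ _ _) _ _ => //=.
congr (_, _); apply: funext => h; rewrite /upd.
case: (h =P i) => [->|hi]; first by rewrite (negbTE ij).
by case: eqP => // ->; rewrite /tops; case: (s i).
Qed.
Arguments exec_mv {i j} m s _.

Lemma exec_drain i j m s : i != j ->
  ex (drain i j) (1 + 3 * size (s i)) [::] (m, s)
     (m, upd (upd s i [::]) j (rev (s i) ++ s j)).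
Proof.
move=> ij; move e: (s i) => u; elim: u s e => [|b u IH] s e.
  apply: exec_conv (exec_while0 _) _ _ => //=.
    by rewrite /nonempty /tops e.
  by congr (_, _); upd_tac.
apply: exec_conv (exec_whileS _ (exec_mv _ _ ij) (IH _ _)) _ _.
- by rewrite /nonempty /tops /= e.
- by rewrite /upd (negbTE ij) eqxx e.
- rewrite /=; lia.
- congr (_, _); rewrite rev_cons cat_rcons e /=.
  upd_tac.
Qed.

Lemma exec_clear i m s :
  ex (clear i) (1 + 3 * size (s i)) [::] (m, s) (m, upd s i [::]).
Proof.
move e: (s i) => u; elim: u s e => [|b u IH] s e.
  apply: exec_conv (exec_while0 _) _ _ => //=.
    by rewrite /nonempty /tops e.
  by congr (_, _); upd_tac.
apply: exec_conv (exec_whileS _ (exec_pop _ _ _) (IH _ _)) _ _.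
- by rewrite /nonempty /tops /= e.
- by rewrite /upd eqxx e.
- rewrite /=; lia.
- by congr (_, _); upd_tac.
Qed.

(** The loop stops at the separator [false] or at the end of a string that lacks it. The remainder
    [v] is therefore only specified through [behead v], which is what the final pop leaves in both
    cases. *)
Lemma exec_unpair_loop i j m s : i != j ->
  exists2 v, behead v = (unpair (s j) (s i)).2 &
  ex (While (fun _ t => t i == Some true) (Seq (pop1 i) (mv i j)))
     (1 + 5 * size (s i)) [::] (m, s)
     (m, upd (upd s i v) j (unpair (s j) (s i)).1).
Proof.
move=> ij; have ji : (j == i) = false by rewrite eq_sym (negbTE ij).
have [n] := ubnP (size (s i)); elim: n s => // n IH s hn.
case e: (s i) => [|[] u].
- exists [::] => //.
  apply: exec_conv (exec_while0 _) _ _ => //=; first by rewrite /tops e.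
  by congr (_, _); upd_tac.
- set s1 := upd s i u.
  set s2 := upd (upd s1 i (behead u)) j (seq_of_opt (ohead u) ++ s1 j).
  have h2i : s2 i = behead u by rewrite /s2 /s1 /upd eqxx (negbTE ij).
  have h2j : s2 j = seq_of_opt (ohead u) ++ s j by rewrite /s2 /s1 /upd eqxx ji.
  have E : ex (Seq (pop1 i) (mv i j)) 4 [::] (m, s) (m, s2).
    apply: exec_conv (exec_seq (exec_pop _ _ _) (exec_mv _ _ ij)) _ _ => //.
    by congr (_, _); rewrite /s2 /s1 e /=; upd_tac.
  have sz : size (s2 i) < n.
    by rewrite h2i; move: hn; rewrite e size_behead /=; lia.
  have hp : unpair (s2 j) (s2 i) = unpair (s j) (true :: u).
    by rewrite h2i h2j; case: (u).
  have [v hv1 hv2] := IH s2 sz; exists v; first by rewrite hv1 hp.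
  apply: exec_conv (exec_whileS _ E hv2) _ _.
  + by rewrite /tops /= e.
  + by rewrite h2i size_behead /=; lia.
  + by congr (_, _); rewrite hp /s2 /s1; upd_tac.
- exists (false :: u) => //.
  apply: exec_conv (exec_while0 _) _ _ => //=; first by rewrite /tops e.
  by congr (_, _); upd_tac.
Qed.

Lemma exec_unpair i j m s : i != j ->
  ex (unpair_into i j) (3 + 5 * size (s i)) [::] (m, s)
     (m, upd (upd s i (unpair (s j) (s i)).2) j (unpair (s j) (s i)).1).
Proof.
move=> ij; have [v hv1 hv2] := exec_unpair_loop m s ij.
apply: exec_conv (exec_seq hv2 (exec_pop _ _ _)) _ _; first lia.
by congr (_, _); rewrite -hv1; upd_tac.
Qed.

Lemma exec_mark i j m s : i != j ->
  ex (mark_into i j) (1 + 5 * size (s i)) [::] (m, s)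
     (m, upd (upd s i [::]) j (mark (rev (s i)) ++ s j)).
Proof.
move=> ij; have ji : (j == i) = false by rewrite eq_sym (negbTE ij).
move e: (s i) => u; elim: u s e => [|b u IH] s e.
  apply: exec_conv (exec_while0 _) _ _ => //=.
    by rewrite /nonempty /tops e.
  by congr (_, _); upd_tac.
apply: exec_conv (exec_whileS _ (exec_seq (exec_mv _ _ ij) (exec_push _ _ _ _)) (IH _ _)) _ _.
- by rewrite /nonempty /tops /= e.
- by rewrite /upd (negbTE ij) eqxx e.
- rewrite /=; lia.
- congr (_, _); rewrite rev_cons -cats1 mark_cat e /= -catA /=.
  by upd_tac.
Qed.

Lemma exec_unmark i j m s : i != j ->
  ex (unmark_into i j) (1 + 5 * size (s i)) [::] (m, s)
     (m, upd (upd s i [::]) j (rev (mark (s i)) ++ s j)).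
Proof.
move=> ij; have ji : (j == i) = false by rewrite eq_sym (negbTE ij).
move e: (s i) => u; elim: u s e => [|b u IH] s e.
  apply: exec_conv (exec_while0 _) _ _ => //=.
    by rewrite /nonempty /tops e.
  by congr (_, _); upd_tac.
apply: exec_conv (exec_whileS _ (exec_seq (exec_push _ _ _ _) (exec_mv _ _ ij)) (IH _ _)) _ _.
- by rewrite /nonempty /tops /= e.
- by rewrite /upd (negbTE ij) eqxx e.
- rewrite /=; lia.
- congr (_, _); rewrite /= !rev_cons -!cats1 -!catA /= /upd (negbTE ij) e.
  by upd_tac.
Qed.

Lemma exec_drain2 i i' j j' m s (n := minn (size (s i)) (size (s j))) :
  uniq [:: i; i'; j; j'] ->
  ex (drain2 i i' j j') (1 + 5 * size (s i)) [::] (m, s)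
     (m, upd (upd (upd (upd s i (drop n (s i))) i' (rev (take n (s i)) ++ s i'))
       j (drop n (s j))) j' (rev (take n (s j)) ++ s j')).
Proof.
rewrite {}/n /= !inE !negb_or => /and4P[/and3P[n1 n2 n3] /andP[n4 n5] n6 _].
move e: (s i) => u; elim: u s e => [|b u IH] s e.
  rewrite min0n !take0 !drop0.
  apply: exec_conv (exec_while0 _) _ _ => //=.
    by rewrite /nonempty /tops e.
  by congr (_, _); upd_tac.
case e' : (s j) => [|b' v].
  rewrite minn0 !take0 !drop0.
  apply: exec_conv (exec_while0 _) _ _ => //=.
    by rewrite /nonempty /tops e' andbF.
  by congr (_, _); upd_tac.
pose s' := upd (upd (upd (upd s i u) i' (b :: s i')) j v) j' (b' :: s j').
have E : ex (Seq (mv i i') (mv j j')) 4 [::] (m, s) (m, s').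
  apply: exec_conv (exec_seq (exec_mv _ _ n1) (exec_mv _ _ n6)) _ _ => //.
  have -> : upd (upd s i (behead (s i))) i' (seq_of_opt (ohead (s i)) ++ s i') j = b' :: v.
    by rewrite -e'; upd_val.
  have -> : upd (upd s i (behead (s i))) i' (seq_of_opt (ohead (s i)) ++ s i') j' = s j'.
    by upd_val.
  by rewrite e.
have e1 : s' i = u by rewrite /s'; upd_val.
have e2 : s' j = v by rewrite /s'; upd_val.
have e3 : s' i' = b :: s i' by rewrite /s'; upd_val.
have e4 : s' j' = b' :: s j' by rewrite /s'; upd_val.
apply: exec_conv (exec_whileS _ E (IH s' e1)) _ _.
- by rewrite /nonempty /tops /= e e'.
- rewrite /=; lia.
- rewrite e2 e3 e4 /= minnSS /= !rev_cons !cat_rcons /s'.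
  by congr (_, _); upd_tac.
Qed.

End Macros.

Arguments push1 {F I} i b.
Arguments pop1 {F I} i.
Arguments mv {F I} i j.
Arguments drain {F I} i j.
Arguments clear {F I} i.
Arguments unpair_into {F I} i j.
Arguments mark_into {F I} i j.
Arguments unmark_into {F I} i j.
Arguments drain2 {F I} i i' j j'.
Arguments exec_conv {F I qi ai phi c N N' qs x y y'} _ _ _.
Arguments exec_push {F I qi ai phi} i b m s.
Arguments exec_pop {F I qi ai phi} i m s.
Arguments exec_mv {F I qi ai phi i j} m s _.
Arguments exec_drain {F I qi ai phi i j} m s _.
Arguments exec_clear {F I qi ai phi} i m s.
Arguments exec_unpair {F I qi ai phi i j} m s _.
Arguments exec_mark {F I qi ai phi i j} m s _.
Arguments exec_unmark {F I qi ai phi i j} m s _.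
Arguments exec_drain2 {F I qi ai phi i i' j j'} m s _.

(** * Polynomial-time string functions given by programs *)

Fixpoint apply_list (k : nat) : den (str_fun k) -> seq str -> str :=
  match k return den (str_fun k) -> seq str -> str with
  | 0 => fun f _ => f
  | k'.+1 => fun f a => apply_list (f (head [::] a)) (behead a)
  end.

Lemma uncurry_strE k (f : den (str_fun k)) (a : k.-tuple str) :
  uncurry_str f a = apply_list f a.
Proof.
elim: k f a => [//|k IH] f a /=; rewrite IH.
by case: a => [[|x a] ha].
Qed.

Lemma FP_of_program (F I : finType) (c : cmd F I) (m0 : F) k (l : seq I) (out : I)
    (f : den (str_fun k.+1)) C d :
  uniq l -> size l = k.+1 -> ask_free c ->
  (forall phi a, size a = k.+1 -> exists N m s,
     [/\ exec out out phi c N [::] (m0, load_inputs l a) (m, s),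
         s out = apply_list f a & N <= C * (\max_(x <- a) size x).+1 ^ d]) ->
  FP_class f.
Proof.
move=> l_uniq l_size hc h; constructor.
apply: (@polytime_of_program _ _ _ m0 _ _ out _ C d l_uniq l_size hc) => phi a.
have [N [m [s [h1 h2 h3]]]] := h phi a (size_tuple a).
exists N, m, s; split=> //.
by rewrite uncurry_strE.
Qed.

Section Stores.

Variable n : nat.

(** With the stacks given by an explicit list, the effect of a program can be computed by
    simplification. *)
Definition store (l : seq str) : 'I_n -> str := fun i => nth [::] l i.

Lemma upd_store l (i : 'I_n) x : upd (store l) i x = store (set_nth [::] l i x).
Proof. by apply: funext => j; rewrite /upd /store nth_set_nth. Qed.

Lemma storeE l i : store l i = nth [::] l i.
Proof. by []. Qed.

End Stores.

Ltac store_tac := do ?[rewrite ?upd_store ?storeE /=].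

Local Notation stk k := (@Ordinal 8 k isT).

Definition push_all (s : str) : cmd unit 'I_8 :=
  foldr (fun b c => Seq c (push1 (stk 1) b)) (clear (stk 1)) s.

Lemma FP_const (s : str) : @FP_class (Arr Str Str) (fun _ => s).
Proof.
apply: (@FP_of_program _ _ (push_all s) tt 0 [:: stk 0] (stk 1) _ (1 + 2 * size s) 0) => //.
  by elim: s => //= b s ->.
move=> phi [|x []] // _; exists (1 + 2 * size s), tt, (store [:: x; s]).
split=> //; last by rewrite expn0 muln1.
have -> : load_inputs [:: stk 0] [:: x] = store [:: x].
  by apply: funext => -[[|[|j]] hj].
elim: s => [|b s IH] /=.
  by apply: exec_conv (exec_clear _ _ _) _ _; rewrite ?upd_store.
apply: exec_conv (exec_seq IH (exec_push _ _ _ _)) _ _; first lia.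
by rewrite upd_store.
Qed.

(** Strings serve as unary numbers through their lengths; this function alone supplies sums,
    successors and products for the bounds and counters of limited recursions. *)
Definition mul_add (x y z : str) : str := nseq (size x * size y) true ++ z.

Definition mul_add_program : cmd unit 'I_8 :=
  While (nonempty (stk 0)) (Seq (pop1 (stk 0))
    (Seq (While (nonempty (stk 1)) (Seq (mv (stk 1) (stk 3)) (push1 (stk 2) true)))
         (drain (stk 3) (stk 1)))).

Lemma nseq_catl n (b : bool) s : nseq n b ++ b :: s = b :: nseq n b ++ s.
Proof. by elim: n => //= n ->. Qed.

Lemma FP_mul_add : @FP_class (Arr Str (Arr Str (Arr Str Str))) mul_add.
Proof.
apply: (@FP_of_program _ _ mul_add_program tt 2 [:: stk 0; stk 1; stk 2] (stk 2) _ 10 2) => //.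
move=> phi [|x [|y [|z []]]] // _.
exists (1 + size x * (5 + 8 * size y)), tt, (store [:: [::]; y; mul_add x y z; [::]]); split=> //; last first.
  rewrite !big_cons big_nil maxn0; set v := maxn _ _.
  have : size x <= v by rewrite leq_maxl.
  have : size y <= v by rewrite !leq_max leqnn orbT.
  move: (size x) (size y) => a b; rewrite expnS expn1; nia.
have -> : load_inputs [:: stk 0; stk 1; stk 2] [:: x; y; z] = store [:: x; y; z; [::]].
  by apply: funext => -[[|[|[|[|j]]]] hj] //; rewrite /store /load_inputs /= nth_nil.
(* One pass over [y] pushes one symbol per bit and leaves [y] reversed on stack 3, from where it is
   drained back for the next round. *)
have inner x0 y1 y2 z1 : exec (stk 2) (stk 2) phi
    (While (nonempty (stk 1)) (Seq (mv (stk 1) (stk 3)) (push1 (stk 2) true)))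
    (1 + 5 * size y1) [::] (tt, store [:: x0; y1; z1; y2])
    (tt, store [:: x0; [::]; nseq (size y1) true ++ z1; rev y1 ++ y2]).
  elim: y1 y2 z1 => [|b y1 IH] y2 z1; first exact: exec_while0.
  have E : exec (stk 2) (stk 2) phi (Seq (mv (stk 1) (stk 3)) (push1 (stk 2) true))
      4 [::] (tt, store [:: x0; b :: y1; z1; y2])
      (tt, store [:: x0; y1; true :: z1; b :: y2]).
    apply: exec_conv (exec_seq (exec_mv _ _ _) (exec_push _ _ _ _)) _ _ => //.
    by store_tac.
  apply: exec_conv (exec_whileS _ E (IH _ _)) _ _ => //; first by rewrite /=; lia.
  by rewrite nseq_catl rev_cons cat_rcons.
rewrite /mul_add /mul_add_program; elim: x z => [|b x IH] z; first exact: exec_while0.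
set w := While (nonempty (stk 1)) _ in inner *.
have E : exec (stk 2) (stk 2) phi (Seq (pop1 (stk 0)) (Seq w (drain (stk 3) (stk 1))))
    (4 + 8 * size y) [::] (tt, store [:: b :: x; y; z; [::]])
    (tt, store [:: x; y; nseq (size y) true ++ z; [::]]).
  apply: exec_conv (exec_seq (exec_pop _ _ _)
    (exec_seq (qs1 := [::]) (y := (tt, store [:: x; [::]; nseq (size y) true ++ z; rev y]))
      _ (exec_drain _ _ _))) _ _ => //.
  - by store_tac; rewrite -[rev y]cats0; apply: inner.
  - by store_tac; rewrite size_rev; lia.
  - by store_tac; rewrite ?cats0 revK.
apply: exec_conv (exec_whileS _ E (IH _)) _ _ => //=; first lia.
by rewrite catA -nseqD mulSn addnC.
Qed.

(* Transcripts of answers are kept reversed, the last answer on top. *)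
Definition add_entry (c y s : str) : str :=
  false :: rev (mark (rev (take (size c) s))) ++ y.

Lemma take_minn (T : Type) n (s : seq T) : take (minn n (size s)) s = take n s.
Proof.
by case: leqP => // h; rewrite take_size take_oversize // ltnW.
Qed.

(** Draining the answer in parallel with the first argument truncates it and leaves it reversed, in
    the order in which the reversed marking needs it. *)
Lemma FP_add_entry : @FP_class (Arr Str (Arr Str (Arr Str Str))) add_entry.
Proof.
pose c : cmd unit 'I_8 := Seq (drain2 (stk 0) (stk 3) (stk 2) (stk 4))
  (Seq (unmark_into (stk 4) (stk 1)) (push1 (stk 1) false)).
apply: (@FP_of_program _ _ c tt 2 [:: stk 0; stk 1; stk 2] (stk 1) _ 14 1) => //.
move=> phi [|x [|y [|z []]]] // _.
have -> : load_inputs [:: stk 0; stk 1; stk 2] [:: x; y; z] = store [:: x; y; z; [::]; [::]].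
  by apply: funext => -[[|[|[|[|[|j]]]]] hj] //; rewrite /store /load_inputs /= nth_nil.
eexists _, _, _; split.
- by apply: exec_seq (exec_drain2 _ _ _) (exec_seq (exec_unmark _ _ _) (exec_push _ _ _ _)).
- by rewrite /= /upd /= /store /= cats0 take_minn.
- rewrite !big_cons big_nil maxn0 expn1 /= /upd /= /store /= cats0.
  rewrite size_rev size_take; set v := maxn _ _.
  have : size x <= v by rewrite leq_maxl.
  have := geq_minl (size x) (size z); case: ifP; lia.
Qed.

Definition longer_answer (q fq best fbest : str) : str :=
  if size fbest < size fq then q else best.

Lemma FP_longer_answer :
  @FP_class (Arr Str (Arr Str (Arr Str (Arr Str Str)))) longer_answer.
Proof.
pose c : cmd unit 'I_8 := Seq (drain2 (stk 1) (stk 4) (stk 3) (stk 5))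
  (Seq (If (nonempty (stk 1)) (drain (stk 0) (stk 6)) (drain (stk 2) (stk 6)))
       (drain (stk 6) (stk 7))).
apply: (@FP_of_program _ _ c tt 3 [:: stk 0; stk 1; stk 2; stk 3] (stk 7) _ 20 1) => //.
move=> phi [|q [|fq [|b [|fb []]]]] // _.
(* After draining both answers in parallel, a symbol of the first is left exactly if it is strictly
   longer. *)
have hb : (ohead (drop (minn (size fq) (size fb)) fq) != None) = (size fb < size fq).
  have := size_drop (minn (size fq) (size fb)) fq.
  case: (drop _ _) => [|y r] /=; lia.
rewrite /= /longer_answer; move: hb; case: (size fb < size fq) => hb.
  eexists _, _, _; split.
  - apply: exec_seq (exec_drain2 _ _ _) (exec_seq (exec_if (qs := [::]) _) (exec_drain _ _ _)) => //.
    rewrite (_ : nonempty _ _ _ = true); first exact: exec_drain.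
    exact: hb.
  - by rewrite /= /upd /= !cats0 revK.
  - rewrite !big_cons big_nil maxn0 expn1 /= /upd /= /load_inputs /= cats0 size_rev; lia.
eexists _, _, _; split.
- apply: exec_seq (exec_drain2 _ _ _) (exec_seq (exec_if (qs := [::]) _) (exec_drain _ _ _)) => //.
  rewrite (_ : nonempty _ _ _ = false); first exact: exec_drain.
  exact: hb.
- by rewrite /= /upd /= !cats0 revK.
- rewrite !big_cons big_nil maxn0 expn1 /= /upd /= /load_inputs /= cats0 size_rev; lia.
Qed.

(** * Operators in MPT for pairing and for limited recursion *)

Definition ask_pair (phi : str -> str) (a : str) : str := pair_str a (phi [::]).

(** The answer stays on the stack where it arrives and the marked argument is pushed on top of it,
    so the time is linear in the argument, however long the answer. *)
Lemma MPT_ask_pair : MPT ask_pair.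
Proof.
pose c : cmd unit 'I_8 := Seq (Ask _ _) (Seq (push1 (stk 1) false) (mark_into (stk 0) (stk 1))).
apply: (@MPT_of_program _ _ (stk 2) (stk 1) c tt (stk 0) (stk 1) _ 10 1) => phi x.
eexists _, _, _, _; split.
- by apply: exec_seq (exec_ask _ _) (exec_seq (exec_push _ _ _ _) (exec_mark _ _ _)).
- by [].
- rewrite expn1 /= /upd /= /load_inputs /=; lia.
- by move=> q; rewrite /= inE => /eqP ->.
Qed.

(** These two decode the queries of [rec_op] below: the value so far, and the recursion argument
    turned back from its reversal. *)
Definition entry_of (phi : str -> str) (x : str) : str := (unpair [::] x).1.
Definition rest_of (phi : str -> str) (x : str) : str := rev (unpair [::] x).2.

Lemma MPT_entry_rest : MPT entry_of /\ MPT rest_of.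
Proof.
pose c : cmd unit 'I_8 := Seq (unpair_into (stk 0) (stk 1)) (drain (stk 0) (stk 2)).
have h phi x : exists N m s, [/\
    exec (stk 2) (stk 2) phi c N [::] (tt, load_inputs [:: stk 0] [:: x]) (m, s),
    s (stk 1) = entry_of phi x, s (stk 2) = rest_of phi x &
    N <= 14 * (size x).+1 ^ 1].
  eexists _, _, _; split.
  - by apply: exec_seq (exec_unpair _ _ _) (exec_drain _ _ _).
  - by [].
  - by rewrite /= /upd /= /load_inputs /= cats0.
  - rewrite expn1 /= /upd /= /load_inputs /=.
    have := size_unpair [::] x; rewrite /=; lia.
split.
  apply: (@MPT_of_program _ _ (stk 2) (stk 2) c tt (stk 0) (stk 1) _ 14 1) => phi x.
  by have [N [m [s [h1 h2 _ h3]]]] := h phi x; exists N, [::], m, s.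
apply: (@MPT_of_program _ _ (stk 2) (stk 2) c tt (stk 0) (stk 2) _ 14 1) => phi x.
by have [N [m [s [h1 _ h2 h3]]]] := h phi x; exists N, [::], m, s.
Qed.

(** The input packs [c], [a] and [b] in this order. The oracle gets the recursion argument reversed,
    because extending it on the right is then a single push. *)
Definition rec_op (phi : str -> str) (x : str) : str :=
  let cx := unpair [::] x in
  let ax := unpair [::] cx.2 in
  let bx := unpair [::] ax.2 in
  limited_rec (fun s v => phi (pair_str v (rev s))) ax.1 bx.1 cx.1.

(** Stack 0 holds the consumed part of [c] reversed and is completed to the query, stack 1 receives
    the answer, stack 2 is the rest of [c], stack 3 the current value, stack 4 is [b]; stacks 5 and
    6 are scratch. *)
Definition rec_body : cmd unit 'I_8 :=
  Seq (Seq (mv (stk 2) (stk 0)) (Seq (push1 (stk 0) false) (mark_into (stk 3) (stk 0))))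
  (Seq (Ask _ _) (Seq (Seq (unpair_into (stk 0) (stk 3)) (clear (stk 3)))
  (Seq (drain2 (stk 4) (stk 5) (stk 1) (stk 6))
       (Seq (drain (stk 5) (stk 4)) (drain (stk 6) (stk 3)))))).

Section RecBody.

Variable phi : str -> str.
Local Notation ex := (exec (stk 0) (stk 1) phi).

(** The part of the answer beyond the truncation stays behind as [w'] until the next answer
    overwrites it. Hence the time does not depend on the length of the answer. *)
Lemma exec_rec_body p w d c y b (q := pair_str y (d :: p)) : exists w',
  ex rec_body (40 + 20 * size y + 11 * size b + 5 * size p) [:: q]
    (tt, store [:: p; w; d :: c; y; b; [::]; [::]])
    (tt, store [:: d :: p; w'; c; take (size b) (phi q); b; [::]; [::]]).
Proof.
exists (drop (minn (size b) (size (phi q))) (phi q)).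
have E1 : ex (Seq (mv (stk 2) (stk 0)) (Seq (push1 (stk 0) false) (mark_into (stk 3) (stk 0))))
    (5 + 5 * size y) [::]
    (tt, store [:: p; w; d :: c; y; b; [::]; [::]])
    (tt, store [:: q; w; c; [::]; b; [::]; [::]]).
  apply: exec_conv (exec_seq (exec_mv _ _ _) (exec_seq (exec_push _ _ _ _)
    (exec_mark _ _ _))) _ _ => //.
  by store_tac.
have E2 : ex (Ask _ _) 1 [:: q] (tt, store [:: q; w; c; [::]; b; [::]; [::]])
    (tt, store [:: q; phi q; c; [::]; b; [::]; [::]]).
  apply: exec_conv (exec_ask _ _) _ _ => //; by store_tac.
have E3 : ex (Seq (unpair_into (stk 0) (stk 3)) (clear (stk 3)))
    (4 + 5 * size q + 3 * size y) [::] (tt, store [:: q; phi q; c; [::]; b; [::]; [::]])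
    (tt, store [:: d :: p; phi q; c; [::]; b; [::]; [::]]).
  apply: exec_conv (exec_seq (exec_unpair _ _ _) (exec_clear _ _ _)) _ _ => //;
    rewrite ?upd_store ?storeE /= unpair_pair /=; store_tac; last by [].
  lia.
have E4 : ex (Seq (drain2 (stk 4) (stk 5) (stk 1) (stk 6))
    (Seq (drain (stk 5) (stk 4)) (drain (stk 6) (stk 3))))
    (3 + 11 * size b) [::] (tt, store [:: d :: p; phi q; c; [::]; b; [::]; [::]])
    (tt, store [:: d :: p; drop (minn (size b) (size (phi q))) (phi q); c;
                   take (size b) (phi q); b; [::]; [::]]).
  apply: exec_conv (exec_seq (exec_drain2 _ _ _)
    (exec_seq (exec_drain _ _ _) (exec_drain _ _ _))) _ _ => //; store_tac.
    rewrite !cats0 !size_rev !size_takel ?geq_minl ?geq_minr //; lia.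
  by rewrite !cats0 !revK cat_take_drop take_minn.
apply: exec_conv (exec_seq E1 (exec_seq E2 (exec_seq E3 E4))) _ _ => //.
rewrite /q size_cat size_mark size_rev /=; lia.
Qed.

(** Every value of the recursion is [a] or truncated to the length of [b], which bounds the queries.
    That [c] is nonempty when a query is posed is recorded for the comparison with the length of the
    packed input. *)
Lemma exec_rec_loop a b p c w K
    (y := limited_rec (fun s v => phi (pair_str v (rev s))) a b) :
  size a <= K -> size b <= K -> size p + size c <= K ->
  exists w' p' qs, ex (While (nonempty (stk 2)) rec_body)
    (1 + size c * (41 + 36 * K)) qs
    (tt, store [:: p; w; c; y (rev p); b; [::]; [::]])
    (tt, store [:: p'; w'; [::]; y (rev p ++ c); b; [::]; [::]]) /\
  {in qs, forall q,
    0 < size c /\ size q <= (maxn (size a) (size b)).*2 + 1 + size p + size c}.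
Proof.
move=> ha hb; elim: c p w => [|d c IH] p w hp.
  by exists w, p, [::]; split=> //; rewrite cats0; apply: exec_while0.
have sy s : size (y s) <= maxn (size a) (size b).
  rewrite /y /limited_rec; case: (rev s) => [|i t] /=; first by rewrite leq_maxl.
  by rewrite size_take_min; lia.
have [w1 E] := exec_rec_body p w d c (y (rev p)) b.
have hp' : size (d :: p) + size c <= K by move: hp => /=; lia.
have [w2 [p2 [qs [E' hq]]]] := IH (d :: p) w1 hp'.
have ey : y (rev (d :: p)) = take (size b) (phi (pair_str (y (rev p)) (d :: p))).
  by rewrite rev_cons /y limited_rec_rcons rev_rcons revK.
rewrite -ey in E; exists w2, p2, (pair_str (y (rev p)) (d :: p) :: qs); split.
  apply: exec_conv (exec_whileS _ E E') _ _ => //.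
    move: (sy (rev p)) hp; rewrite /=; nia.
  by rewrite rev_cons cat_rcons.
move=> q; rewrite inE => /orP[/eqP ->|/hq /=]; last by lia.
split=> //.
rewrite size_cat size_mark size_rev /=; move: (sy (rev p)); lia.
Qed.

End RecBody.

Lemma MPT_rec_op : MPT rec_op.
Proof.
pose c : cmd unit 'I_8 := Seq (Seq (Ask _ _) (Seq (unpair_into (stk 0) (stk 2))
  (Seq (unpair_into (stk 0) (stk 3)) (Seq (unpair_into (stk 0) (stk 4)) (clear (stk 0))))))
  (While (nonempty (stk 2)) rec_body).
apply: (@MPT_of_program _ _ (stk 0) (stk 1) c tt (stk 0) (stk 3) _ 100 2) => phi x.
have -> : load_inputs [:: stk 0] [:: x] = store [:: x; [::]; [::]; [::]; [::]; [::]; [::]].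
  by apply: funext => -[[|[|[|[|[|[|[|j]]]]]]] hj] //; rewrite /store /load_inputs /= nth_nil.
have s1 := size_unpair [::] x; case e1: (unpair [::] x) s1 => [c' x1] /= s1.
have s2 := size_unpair [::] x1; case e2: (unpair [::] x1) s2 => [a x2] /= s2.
have s3 := size_unpair [::] x2; case e3: (unpair [::] x2) s3 => [b x3] /= s3.
have ha : size a <= size x by lia.
have hb : size b <= size x by lia.
have hc : size ([::] : str) + size c' <= size x by rewrite /=; lia.
have [w' [p' [qs [E hq]]]] := exec_rec_loop phi (phi x) ha hb hc.
eexists _, _, _, _; split.
- apply: exec_seq E; apply: (exec_conv (N' := 11 + 18 * size x)).
    by apply: exec_seq (exec_ask _ _) (exec_seq (exec_unpair _ _ _)
     (exec_seq (exec_unpair _ _ _) (exec_seq (exec_unpair _ _ _) (exec_clear _ _ _)))).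
  store_tac; rewrite e1 /= e2 /= e3 /=; lia.
  store_tac; by rewrite e1 /= e2 /= e3 /=.
- by rewrite /rec_op e1 /= e2 /= e3 /=.
- rewrite expnS expn1; nia.
(* The first query is the input. It is at least twice as long as [c'], [a] and [b] together; as [c']
   is nonempty for any later query, this leaves room for the separator. *)
- move=> q /=; rewrite inE => /orP[/eqP -> //|hqs].
  have [] := hq q hqs; rewrite /= storeE /=; lia.
Qed.

(** * Simulation of Turing machines by stack programs *)

(* Half a tape is kept on two stacks, [d] for the bits and [e] for flags that tell
   which cells are blank. A missing flag stands for a cell that is not blank, so
   that a string on [d] is a tape content without further preparation. *)
Fixpoint cells (d e : str) : seq symbol :=
  if d is b :: d' then (if head false e then None else Some b) :: cells d' (behead e)
  else [::].

Definition top_cell (x y : symbol) : symbol := if y == Some true then None else x.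

Definition cell_bit (w : symbol) (data : bool) : bool :=
  if data then odflt false w else w == None.

Arguments cell_bit : simpl never.

Lemma cells_nil d : cells d [::] = map Some d.
Proof. by elim: d => //= b d ->. Qed.

Lemma cells_behead d e : cells (behead d) (behead e) = behead (cells d e).
Proof. by case: d => [|b d]; case: e. Qed.

Lemma cells_cons w d e :
  cells (cell_bit w true :: d) (cell_bit w false :: e) = w :: cells d e.
Proof. by case: w. Qed.

Lemma top_cellE d e : top_cell (ohead d) (ohead e) = head None (cells d e).
Proof. by case: d => [|b d]; case: e => [|[] e]. Qed.

Arguments cells : simpl never.

Section Simulation.

Variables (k : nat) (M : machine k).

(** Each tape takes four stacks, for its left or right half and for its bits or blank flags. The
    other four hold the clock, the reversed transcript (later the output), the answers still to be
    read, and scratch. *)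
Definition stack := (tape_name M * (bool * bool) + bool * bool)%type.

Definition side (t : tape_name M) (rt data : bool) : stack := inl (t, (rt, data)).
Definition clk : stack := inr (false, false).
Definition ys : stack := inr (false, true).
Definition zs : stack := inr (true, false).
Definition tmp : stack := inr (true, true).

Lemma side_eq t u a b a' b' :
  (side t a b == side u a' b') = [&& t == u, a == a' & b == b'].
Proof. by []. Qed.

Lemma side_inr t a b e : (side t a b == inr e) = false.
Proof. by []. Qed.

Implicit Types (s : stack -> str) (c : config M) (q : state M).

Definition tape_at s (t : tape_name M) : tape :=
  (cells (s (side t false true)) (s (side t false false)),
   cells (s (side t true true)) (s (side t true false))).

Definition simulates s (T : {ffun tape_name M -> tape}) : Prop :=
  forall t, tape_at s t = T t.

(** A transition changes each half tape only near its top, so one primitive suffices. On a left move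
    the right half gets the written cell and, above it, the cell taken from the left half; [PutPush]
    does both. *)
Definition step_prim q (t : stack -> symbol) : state M * (stack -> op) :=
  let cell u rt := top_cell (t (side u rt true)) (t (side u rt false)) in
  let qw := trans q [ffun u => cell u true] in
  (qw.1, fun j =>
     match j with
     | inl (u, (rt, data)) =>
         let w := cell_bit (qw.2 u).1 data in
         match (qw.2 u).2, rt with
         | Stay, true => Put w
         | Stay, false => Keep
         | MoveRight, true => Pop
         | MoveRight, false => Push w
         | MoveLeft, true => PutPush w (cell_bit (cell u false) data)
         | MoveLeft, false => Pop
         end
     | inr _ => Keep
     end).

Lemma size_ap o (s : str) : size (ap o s) <= (maxn (size s) 1).+1.
Proof. by case: o => [||b|b|b b'] /=; rewrite ?size_behead; lia. Qed.

Section Programs.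

Variables (qi ai : stack) (phi : str -> str).
Local Notation ex := (@exec (state M) stack qi ai phi).

Lemma exec_step psi c s : simulates s c.2 -> ~~ halted c -> ask c.1 = None ->
  exists s', [/\ ex (Prim step_prim) 2 [::] (c.1, s) ((step psi c).1, s'),
    simulates s' (step psi c).2, forall e, s' (inr e) = s (inr e) &
    forall j, size (s' j) <= (maxn (size (s j)) 1).+1].
Proof.
move=> hs /negbTE hh hask.
set r := step_prim c.1 (tops s).
have hscan : [ffun u => top_cell (tops s (side u true true)) (tops s (side u true false))]
    = [ffun t => scan (c.2 t)] :> {ffun _ -> symbol}.
  by apply/ffunP => u; rewrite !ffunE top_cellE -hs.
exists (fun j => ap (r.2 j) (s j)); rewrite /step hh hask /=.
split; last 1 first.
- by move=> j; apply: size_ap.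
- have -> : (trans c.1 [ffun t => scan (c.2 t)]).1 = r.1 by rewrite /r /= hscan.
  exact: exec_prim.
- move=> t; rewrite ffunE /tape_at /r /= hscan -hs /tape_at /act /=.
  case: (_ t) => w [] /=.
  + rewrite !cells_behead top_cellE; congr (_, _).
    by rewrite !cells_cons cells_behead.
  + by rewrite !cells_cons cells_behead.
  + by rewrite !cells_cons cells_behead.
- by [].
Qed.

(** The flags of the answer tape are left empty; missing flags mean nonblank cells, so the decoded
    string is a valid tape content at once. *)
Definition load_answer : cmd (state M) stack :=
  let t := answer_tape M in
  Seq (Prim (fun q _ => (odflt q (ask q), fun _ => Keep)))
  (Seq (Seq (clear (side t false true)) (clear (side t false false)))
  (Seq (Seq (clear (side t true true)) (clear (side t true false)))
       (unpair_into zs (side t true true)))).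

Lemma exec_load c s K z (w := unpair [::] z) : simulates s c.2 -> ~~ halted c ->
  ask c.1 != None -> s zs = z -> (forall j, size (s j) <= K) ->
  exists s', [/\ ex load_answer (20 * K + 10) [::] (c.1, s) ((step (fun _ => w.1) c).1, s'),
    simulates s' (step (fun _ => w.1) c).2, s' zs = w.2,
    forall e, inr e != zs -> s' (inr e) = s (inr e) &
    forall j, size (s' j) <= maxn (size (s j)) (size z)].
Proof.
move=> hs /negbTE hh; case eask: (ask c.1) => [q|] // _ hz hK.
rewrite /load_answer; set t := answer_tape M.
pose s1 := upd (upd (upd (upd s (side t false true) [::]) (side t false false) [::])
              (side t true true) [::]) (side t true false) [::].
exists (upd (upd s1 zs w.2) (side t true true) w.1).
have s1z : s1 zs = z by [].
have s1r : s1 (side t true true) = [::].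
  by rewrite /s1 /upd /=; case: eqP => // _; rewrite eqxx.
rewrite /step hh eask /=; split.
- have := @exec_unpair _ _ qi ai phi zs (side t true true) q s1 isT.
  rewrite s1z s1r -/w => E.
  apply: exec_conv (exec_seq (exec_prim _ _ _) (exec_seq
     (exec_seq (exec_clear _ _ _) (exec_clear _ _ _))
     (exec_seq (exec_seq (exec_clear _ _ _) (exec_clear _ _ _)) _))) _ _ => //.
  + rewrite /= eask /=; exact: E.
  + have := hK (side t false true); have := hK (side t false false).
    have := hK (side t true true); have := hK (side t true false).
    have := hK zs; rewrite hz.
    rewrite /upd; do ?case: ifP => _ /=; lia.
- move=> u; rewrite ffunE; case: eqP => [->|/eqP ut].
    by rewrite -/t /tape_at /s1 /upd !side_eq !side_inr eqxx /= !cells_nil.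
  by rewrite -hs /tape_at /s1 /upd !side_eq !side_inr (negbTE ut).
- by [].
- by move=> e /negbTE he; rewrite /s1 /upd /= he.
- have := size_unpair [::] z; rewrite -/w /= => hw.
  move=> j; rewrite /s1 /upd; do ?case: eqP => // _; lia.
Qed.

Definition extract (o : tape_name M) : cmd (state M) stack :=
  let cell t := top_cell (t (side o true true)) (t (side o true false)) in
  Seq (While (fun _ t => cell t != None)
        (Prim (fun q t => (q, fun j =>
           if (j == side o true true) || (j == side o true false) then Pop
           else if j == tmp then (if cell t is Some b then Push b else Keep)
           else Keep))))
      (drain tmp ys).

Lemma exec_extract o q s : s tmp = [::] -> s ys = [::] ->
  exists s', ex (extract o) (2 + 6 * size (s (side o true true))) [::] (q, s) (q, s') /\
             s' ys = str_of_tape (tape_at s o).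
Proof.
move=> ht hy; rewrite /extract /=.
set w := While _ _.
have E d e u s0 : s0 (side o true true) = d -> s0 (side o true false) = e ->
    s0 tmp = u -> exists s', [/\ ex w (1 + 3 * size d) [::] (q, s0) (q, s'),
      s' tmp = rev (blank_free_prefix (cells d e)) ++ u & s' ys = s0 ys].
  elim: d e u s0 => [|b d IH] e u s0 hd he hu.
    exists s0; split=> //; apply: exec_le (exec_while0 _) => //=.
    by rewrite /tops hd he top_cellE.
  case eb: (head false e).
    exists s0; split=> //; last by rewrite /cells /= eb.
    apply: exec_le (exec_while0 _) => //=.
    by rewrite /tops hd he top_cellE /cells /= eb.
  have hc : top_cell (tops s0 (side o true true)) (tops s0 (side o true false)) = Some b.
    by rewrite /tops hd he top_cellE /cells /= eb.
  pose s1 := upd (upd (upd s0 (side o true true) d) (side o true false) (behead e)) tmp (b :: u).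
  have [||| s' [E' ht' hy']] := IH (behead e) (b :: u) s1.
  - by rewrite /s1 /upd !side_eq !side_inr eqxx.
  - by rewrite /s1 /upd !side_eq !side_inr eqxx.
  - by [].
  exists s'; split=> //.
  - apply: exec_conv (exec_whileS (y := (q, s1)) (qs1 := [::]) (N1 := 2) _ _ E') _ _ => //.
    + by rewrite /= hc.
    + apply: exec_conv (exec_prim _ _ _) _ _ => //=; rewrite hc; congr (_, _).
      apply: funext => j; rewrite /s1 /upd.
      case: (j =P side o true true) => [->|_]; first by rewrite side_eq side_inr eqxx hd.
      case: (j =P side o true false) => [->|_]; first by rewrite side_inr he.
      by case: (j =P tmp) => [->|_]; rewrite ?hu.
    + rewrite /=; lia.
  - by rewrite ht' [cells (b :: d) e]/cells /= eb -/cells rev_cons cat_rcons.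
have [s1 [E1 ht1 hy1]] := E _ _ _ s erefl erefl erefl.
rewrite ht cats0 in ht1; rewrite hy in hy1.
eexists; split.
  apply: exec_le (exec_seq E1 (exec_drain _ _ _)) => //.
  rewrite ht1 size_rev.
  have : size (blank_free_prefix (cells (s (side o true true)) (s (side o true false)))) <=
         size (s (side o true true)).
    elim: (s (side o true true)) (s (side o true false)) => //= b d IH e.
    by rewrite /cells /= -/cells; case: (head false e) => //=; rewrite ltnS IH.
  lia.
by rewrite /= /upd /= hy1 ht1 cats0 revK.
Qed.

(** A step poses at most one query, so a constant oracle returning the next entry of the transcript
    is enough. *)
Definition sim_step (x : config M * str) : config M * str :=
  let w := unpair [::] x.2 in
  (step (fun _ => w.1) x.1, if ask x.1.1 is Some _ then w.2 else x.2).

Definition stuck (x : config M * str) : bool :=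
  halted x.1 || (ask x.1.1 != None) && (x.2 == [::]).

Fixpoint sim (n : nat) (x : config M * str) : config M * str :=
  if n is n'.+1 then if stuck x then x else sim n' (sim_step x) else x.

Definition sim_loop : cmd (state M) stack :=
  While (fun q t => (t clk != None) &&
                    ~~ (halting q || (ask q != None) && (t zs == None)))
    (Seq (pop1 clk) (If (fun q _ => ask q != None) load_answer (Prim step_prim))).

(** A transition lengthens a stack by at most one symbol beyond length one, and a loaded entry is no
    longer than the transcript. Each step takes one symbol off the clock, so [K] keeps bounding
    stack size plus remaining steps. *)
Lemma exec_sim_loop K n s c z : size (s clk) = n -> s zs = z ->
  s tmp = [::] -> s ys = [::] -> simulates s c.2 ->
  (forall j, maxn (size (s j)) 1 + n <= K) ->
  exists s', [/\ ex sim_loop (1 + n * (20 * K + 20)) [::] (c.1, s) ((sim n (c, z)).1.1, s'),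
    simulates s' (sim n (c, z)).1.2, s' zs = (sim n (c, z)).2,
    s' tmp = [::] /\ s' ys = [::] & forall j, size (s' j) <= K].
Proof.
elim: n s c z => [|n IH] s c z hn hz ht hy hs hK.
  exists s; split=> //; last by move=> j; have := hK j; lia.
  apply: exec_le (exec_while0 _) => //=.
  by rewrite /tops (size0nil hn).
have htop : (tops s clk != None) by rewrite /tops; case: (s clk) hn.
have hzs : (tops s zs == None) = (z == [::]) by rewrite /tops hz; case: (z).
rewrite /=; case: ifP => hstuck.
  exists s; split=> //; last by move=> j; have := hK j; lia.
  apply: exec_le (exec_while0 _) => //=.
  by rewrite htop hzs; move: hstuck; rewrite /stuck /halted => ->.
pose s1 := upd s clk (behead (s clk)).
have hs1 : simulates s1 c.2 by move=> t; rewrite -hs.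
have K1 j : size (s1 j) <= size (s j).
  by rewrite /s1 /upd; case: eqP => // ->; rewrite size_behead; lia.
have hn1 : size (s1 clk) = n by rewrite /s1 /upd eqxx size_behead hn.
have hh : ~~ halted c by move: hstuck; rewrite /stuck /=; case: halted.
(* The induction hypothesis is applied once, for both kinds of step. *)
have hw N s2 : ex (If (fun q _ => ask q != None) load_answer (Prim step_prim))
      N [::] (c.1, s1) ((sim_step (c, z)).1.1, s2) ->
    N <= 20 * K + 11 -> s2 zs = (sim_step (c, z)).2 -> s2 clk = s1 clk ->
    s2 tmp = [::] -> s2 ys = [::] ->
    simulates s2 (sim_step (c, z)).1.2 ->
    (forall j, size (s2 j) <= (maxn (maxn (size (s j)) 1).+1 (size z))) ->
  exists s', [/\ ex sim_loop (1 + n.+1 * (20 * K + 20)) [::] (c.1, s)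
      ((sim n (sim_step (c, z))).1.1, s'),
    simulates s' (sim n (sim_step (c, z))).1.2, s' zs = (sim n (sim_step (c, z))).2,
    s' tmp = [::] /\ s' ys = [::] & forall j, size (s' j) <= K].
  move=> E hN hz2 hc2 ht2 hy2 hs2 K2.
  have hn2 : size (s2 clk) = n by rewrite hc2.
  have [|s' [E' h1 h2 h3 h4]] := IH s2 (sim_step (c, z)).1 _ hn2 hz2 ht2 hy2 hs2.
    move=> j; have := K2 j; have := hK j; have := hK zs; rewrite hz; lia.
  exists s'; split=> //.
    apply: exec_le (exec_whileS _ (exec_seq (exec_pop _ _ _) E) E'); first by lia.
    by rewrite /= htop hzs; move: hstuck; rewrite /stuck /halted => ->.
case: (boolP (ask c.1 != None)) => hask.
  have K1' j : size (s1 j) <= K by have := hK j; have := K1 j; lia.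
  have [s2 [E h1 h2 h3 h4]] := exec_load hs1 hh hask (hz : s1 zs = z) K1'.
  apply: (hw _ s2 (exec_if (b := fun q _ => ask q != None) _)).
  - by rewrite /= hask; exact: E.
  - lia.
  - by rewrite h2 /sim_step /=; case: (ask c.1) hask.
  - by rewrite h3.
  - by rewrite h3.
  - by rewrite h3.
  - exact: h1.
  - move=> j; have := h4 j; have := K1 j; lia.
have {}hask : ask c.1 = None by case: (ask c.1) hask.
have [s2 [E h1 h2 h3]] := exec_step (fun _ => (unpair [::] z).1) hs1 hh hask.
apply: (hw _ s2 (exec_if (b := fun q _ => ask q != None) _)).
- by rewrite /= hask; exact: E.
- lia.
- by rewrite /sim_step /= hask h2.
- exact: h2.
- by rewrite h2.
- by rewrite h2.
- exact: h1.
- move=> j; have := h3 j; have := K1 j; lia.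
Qed.

(** The test [g] on the final state and on whether the transcript is exhausted decides if the
    content of tape [o] is output; otherwise the output stays empty. Both the next query and the
    final result are obtained in this way. *)
Definition sim_program (g : state M -> bool -> bool) (o : tape_name M) : cmd (state M) stack :=
  Seq (drain ys zs) (Seq sim_loop
    (If (fun q t => g q (t zs == None)) (extract o) (clear tmp))).

Definition run_loop : cmd (state M) stack :=
  While (fun q _ => ~~ halting q) (Prim step_prim).

Lemma exec_run_loop psi K n s c : simulates s c.2 -> oracle_free M ->
  s tmp = [::] -> s ys = [::] -> (forall j, maxn (size (s j)) 1 <= K) ->
  halted (iter n (@step _ M psi) c) ->
  (forall i, i < n -> ~~ halted (iter i (@step _ M psi) c)) ->
  exists s', [/\ ex run_loop (1 + 3 * n) [::] (c.1, s) ((iter n (@step _ M psi) c).1, s'),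
    simulates s' (iter n (@step _ M psi) c).2, s' tmp = [::], s' ys = [::] &
    forall j, size (s' j) <= K + n].
Proof.
move=> hs hfree; elim: n K s c hs => [|n IH] K s c hs ht hy hK hn hi.
  exists s; split=> //; last by move=> j; have := hK j; lia.
  by apply: exec_le (exec_while0 _) => //=; rewrite negbK.
have [s1 [E1 hs1 he1 hk1]] := exec_step psi hs (hi 0 isT) (hfree _).
have [|||||s' [E' h1 h2 h3 h4]] := IH K.+1 s1 (step psi c) hs1.
- by rewrite he1.
- by rewrite he1.
- by move=> j; have := hk1 j; have := hK j; lia.
- by rewrite -iterSr.
- by move=> i hin; rewrite -iterSr; apply: hi.
exists s'; rewrite iterSr; split=> //.
- apply: exec_le (exec_whileS _ E1 E'); first by lia.
  exact: (hi 0 isT).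
- move=> j; have := h4 j; lia.
Qed.

End Programs.

Lemma str_of_tape_at s T o : simulates s T -> str_of_tape (tape_at s o) = str_of_tape (T o).
Proof. by move=> ->. Qed.

End Simulation.

Definition sim_str (M : machine 1) (g : state M -> bool -> bool) (o : tape_name M)
    (a c y : str) : str :=
  let x := sim (size c) (initial M [tuple a], rev y) in
  if g x.1.1 (x.2 == [::]) then str_of_tape (x.1.2 o) else [::].

Lemma load_inputs3 (I : finType) (i1 i2 i3 : I) a b c :
  load_inputs [:: i1; i2; i3] [:: a; b; c] =
  upd (upd (upd (fun _ => [::]) i3 c) i2 b) i1 a.
Proof.
apply: funext => j; rewrite /load_inputs /upd /= ![j == _]eq_sym.
by do !case: ifP.
Qed.

Lemma FP_sim_str (M : machine 1) g (o : tape_name M) :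
  @FP_class (Arr Str (Arr Str (Arr Str Str))) (sim_str g o).
Proof.
pose l := [:: side (input_tape M ord0) true true; clk M; ys M].
apply: (@FP_of_program _ _ (sim_program g o) (start M) 2 l (ys M) _ 250 2) => //.
move=> phi [|a [|c [|y []]]] // _; rewrite load_inputs3.
set s0 := upd _ _ a.
pose s1 := upd (upd s0 (ys M) [::]) (zs M) (rev y).
pose K := maxn (size a) (size y) + 2 * size c + 2.
have E1 : exec (ys M) (ys M) phi (drain (ys M) (zs M)) (1 + 3 * size y) [::]
    (start M, s0) (start M, s1).
  have := exec_drain (start M) (s0) (isT : ys M != zs M).
  by move=> /(_ (ys M) (ys M) phi); rewrite cats0.
have [|||||| s2 [E2 h1 h2 [h3 h4] h5]] :=
  @exec_sim_loop _ _ (ys M) (ys M) phi K (size c) s1 (initial M [tuple a]) (rev y).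
- by [].
- by [].
- by [].
- by [].
- move=> t; rewrite ffunE; case: pickP => [i|hi].
    rewrite (ord1 i) -[0%R]/(@ord0 0) => /eqP <-.
    by rewrite /tape_at /s1 /s0 /upd !side_eq !side_inr !eqxx /= !cells_nil.
  have := hi ord0; rewrite eq_sym => hi0.
  by rewrite /tape_at /s1 /s0 /upd !side_eq !side_inr hi0 /= !cells_nil.
- by move=> j; rewrite /s1 /s0 /upd /K; do !case: ifP => _; rewrite ?size_rev /=; lia.
rewrite /= /sim_str; set x := sim _ _ in E2 h1 h2 *.
have hz : (tops s2 (zs M) == None) = (x.2 == [::]).
  by rewrite /tops h2; case: (x.2).
have [s3 [E3 h6]] := exec_extract (ys M) (ys M) phi o x.1.1 h3 h4.
exists ((1 + 3 * size y) + ((1 + size c * (20 * K + 20)) + (3 + 6 * K))).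
have hN : (1 + 3 * size y) + ((1 + size c * (20 * K + 20)) + (3 + 6 * K)) <=
    250 * (\max_(x <- [:: a; c; y]) size x).+1 ^ 2.
  rewrite !big_cons big_nil maxn0 /K expnS expn1; set v := maxn (size a) (maxn _ _).
  have : maxn (size a) (size y) <= v by rewrite /v; lia.
  have : size c <= v by rewrite !leq_max leqnn orbT.
  have : size y <= v by rewrite !leq_max leqnn !orbT.
  move: (maxn (size a) (size y)) (size c) (size y) => n1 n2 n3; nia.
case: ifP => hg.
  exists x.1.1, s3; split=> //; last by rewrite h6 (str_of_tape_at _ h1).
  apply: exec_seq E1 (exec_seq E2 (exec_if _)).
  rewrite hz hg; apply: exec_le E3; have := h5 (side o true true); lia.
exists x.1.1; eexists; split=> //.
  apply: exec_seq E1 (exec_seq E2 (exec_if _)).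
  rewrite hz hg; apply: exec_le (exec_clear _ _ _); rewrite h3 /=; lia.
by rewrite /upd /= h4.
Qed.

(* The component packed last is the last one of the list. *)
Fixpoint unpack (n : nat) (x : str) : seq str :=
  if n is n'.+1 then
    rcons (unpack n' (unpair [::] x).2) (unpair [::] x).1
  else [::].

Lemma size_unpack n x : size (unpack n x) = n.
Proof. by elim: n x => //= n IH x; rewrite size_rcons IH. Qed.

Lemma size_nth_unpack n x j : size (nth [::] (unpack n x) j) <= size x.
Proof.
elim: n x => [|n IH] x /=; first by rewrite nth_nil.
have h := size_unpair [::] x; rewrite nth_rcons size_unpack.
case: ifP => _; first by apply: leq_trans (IH _) _; move: h => /=; lia.
by case: ifP => // _; move: h => /=; lia.
Qed.

(** * Functions of several strings as unary operators *)

Section Unpacking.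

Variables (k : nat) (M : machine k.+1).

Definition arg_stack (j : 'I_k.+1) : stack M := side (input_tape M j) true true.

Fixpoint unpack_program (n : nat) : cmd (state M) (stack M) :=
  if n is n'.+1 then
    Seq (unpair_into (ys M) (arg_stack (inord n'))) (unpack_program n')
  else clear (ys M).

Lemma arg_stack_eq i j : (arg_stack i == arg_stack j) = (i == j).
Proof.
rewrite /arg_stack side_eq !andbT; apply/eqP/eqP => [|->] //.
exact: input_tape_inj.
Qed.

Lemma exec_unpack qi ai phi q n (s : stack M -> str) x :
  n <= k.+1 -> s (ys M) = x -> (forall j : 'I_k.+1, j < n -> s (arg_stack j) = [::]) ->
  exists s', [/\ exec qi ai phi (unpack_program n) (n.+1 * (3 + 5 * size x)) [::] (q, s) (q, s'),
    s' (ys M) = [::],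
    forall j : 'I_k.+1, j < n -> s' (arg_stack j) = nth [::] (unpack n x) j &
    forall h, h != ys M -> (forall j : 'I_k.+1, j < n -> h != arg_stack j) -> s' h = s h].
Proof.
elim: n s x => [|n IH] s x hn hx hs.
  exists (upd s (ys M) [::]); split=> //.
  - apply: exec_le (exec_clear _ _ _); rewrite hx; lia.
  - by move=> h /negbTE hh _; rewrite /upd hh.
pose i : 'I_k.+1 := inord n.
have hi : i = n :> nat by rewrite inordK.
have hsi : s (arg_stack i) = [::] by apply: hs; rewrite hi.
pose s1 := upd (upd s (ys M) (unpair [::] x).2) (arg_stack i) (unpair [::] x).1.
have E1 : exec qi ai phi (unpair_into (ys M) (arg_stack i)) (3 + 5 * size x) [::] (q, s) (q, s1).
  have := exec_unpair q s (isT : ys M != arg_stack i).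
  by move=> /(_ qi ai phi); rewrite hsi hx.
have hy1 : s1 (ys M) = (unpair [::] x).2 by [].
have hne (j : 'I_k.+1) : j < n -> (arg_stack j == arg_stack i) = false.
  by move=> hj; rewrite arg_stack_eq; apply/eqP => e; move: hj; rewrite e hi ltnn.
have [|s' [E2 h1 h2 h3]] := IH s1 _ (ltnW hn) hy1.
  by move=> j hj; rewrite /s1 /upd hne // side_inr hs // ltnW.
exists s'; split=> //.
- apply: exec_le (exec_seq E1 E2).
  have := size_unpair [::] x; rewrite /=.
  move: (size (unpair _ _).2) (size x) => u v; nia.
- move=> j; rewrite ltnS leq_eqVlt /= nth_rcons size_unpack => /orP[/eqP ej|hj].
    have eji : j = i by apply: val_inj; rewrite /= hi.
    rewrite ej ltnn eqxx eji h3 //; first by rewrite /s1 /upd eqxx.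
    by move=> j' hj'; rewrite eq_sym hne.
  by rewrite hj h2.
- move=> h hh hj; rewrite h3 //; last by move=> j hjn; apply: hj; apply: ltnW.
  by rewrite /s1 /upd (negbTE hh) (negbTE (hj i _)) // hi.
Qed.

End Unpacking.

(** The components of the input are decoded directly onto the input tapes of a simulated machine for
    [f]. None is longer than the input, so the time bound carries over, and no query is posed. *)
Lemma MPT_unpack k (f : k.+1.-tuple str -> str) (g : str -> str) :
  polytime f ->
  (forall (a : k.+1.-tuple str) x, unpack k.+1 x = a -> g x = f a) ->
  MPT (fun _ => g).
Proof.
case=> M [hfree hM [p hp]] hg; have [C [d hC]] := bound_of_poly p.
pose c : cmd (state M) (stack M) :=
  Seq (unpack_program M k.+1) (Seq (run_loop M) (extract (output_tape M))).
apply: (@MPT_of_program _ _ (ys M) (ys M) c (start M) (ys M) (ys M) _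
   (5 * k.+3 + 9 * C + 20) d.+1) => phi x.
pose a : k.+1.-tuple str := tcast (size_unpack k.+1 x) (in_tuple (unpack k.+1 x)).
have ea : unpack k.+1 x = a by rewrite val_tcast.
set s0 := load_inputs _ _.
have s0E j : s0 j = if ys M == j then x else [::].
  by rewrite /s0 /load_inputs /=; case: eqP.
have hy0 : s0 (ys M) = x by rewrite s0E.
have [|s1 [E1 h1 h2 h3]] :=
  @exec_unpack k M (ys M) (ys M) phi (start M) k.+1 s0 x (leqnn _) hy0.
  by move=> j _; rewrite s0E.
have sz1 j : size (s1 j) <= size x.
  case: (boolP (j == ys M)) => [/eqP ->|hj]; first by rewrite h1.
  case: (boolP [exists i, j == arg_stack M i]) => [/existsP[i /eqP ->]|].
    by rewrite h2 // size_nth_unpack.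
  rewrite negb_exists => /forallP he; rewrite h3 //.
  by rewrite s0E eq_sym (negbTE hj).
have [n [hn hnl] hnr] := hM phi a.
have [n' [hn' hnl'] hb] := hp phi a.
have en : n' = n.
  apply/eqP; rewrite eqn_leq; apply/andP; split; rewrite leqNgt; apply/negP.
    by move=> /hnl'; rewrite hn.
  by move=> /hnl; rewrite hn'.
subst n'.
have hq : queries M phi a n = [::].
  rewrite /queries; elim: (iota 0 n) => //= i r ->.
  by rewrite /posed hfree; case: halted.
have hmax : max_length M phi a n <= size x.
  rewrite /max_length hq big_nil maxn0; apply/bigmax_leqP_seq => y.
  move=> /(nthP [::]) [i _ <-] _; rewrite -ea; exact: size_nth_unpack.
have hnC : n <= C * (size x).+1 ^ d.
  apply: leq_trans hb (leq_trans (hC _) _).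
  by rewrite leq_mul2l leq_expn2r ?orbT.
have s1E t b b' : s1 (side t b b') = if b && b' then
    if [pick i | input_tape M i == t] is Some i then tnth a i else [::] else [::].
  have [/andP[-> ->]|hbb] := boolP (b && b'); last first.
    rewrite h3 ?s0E // => j _; rewrite /arg_stack side_eq.
    by move: hbb; case: (b); case: (b'); rewrite ?andbF.
  case: pickP => [i /eqP <-|hi].
    by rewrite -[side _ _ _]/(arg_stack M i) h2 // (tnth_nth [::]) ea.
  by rewrite h3 ?s0E // => j _; rewrite /arg_stack side_eq !andbT eq_sym hi.
have hs1 : simulates s1 (initial M a).2.
  move=> t; rewrite ffunE /tape_at !s1E /= !cells_nil.
  by case: pickP.
have ht1 : s1 (tmp M) = [::] by rewrite h3 ?s0E.
have hK1 j : maxn (size (s1 j)) 1 <= (size x).+1 by have := sz1 j; lia.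
have [s2 [E2 h4 h5 h6 h7]] := exec_run_loop (ys M) (ys M) phi hs1 hfree ht1 h1 hK1 hn hnl.
have [s3 [E3 h8]] := exec_extract (ys M) (ys M) phi (output_tape M) (run M phi a n).1 h5 h6.
eexists _, [::], _, s3; split.
- exact: exec_seq E1 (exec_seq E2 E3).
- rewrite h8 (str_of_tape_at _ h4); rewrite (hg a x ea) -hnr; by [].
- have := h7 (side (output_tape M) true true).
  have : 0 < (size x).+1 ^ d by rewrite expn_gt0.
  move: hnC; rewrite expnS; move: (_.+1 ^ d) => e.
  move: (size (s2 _)) (size x) => u v; nia.
- by [].
Qed.

(** * Definable functionals *)

(** A renaming is described by its effect [r] on environments only; evaluation of renamed terms is
    then the sole fact to prove. *)
Definition var_map G G' (r : env G' -> env G) : Prop :=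
  forall s (x : var G s), exists y : var G' s, forall e, lookup y e = lookup x (r e).

Lemma var_map_lift G G' (r : env G' -> env G) s : var_map r ->
  @var_map (s :: G) (s :: G') (fun e => (e.1, r e.2)).
Proof.
move=> hr t x.
(* The motive matches on the context, so that the variable can be inverted although its context is
   not a free index. *)
pose P G0 t0 (x0 : var G0 t0) : Prop :=
  match G0 return var G0 t0 -> Prop with
  | [::] => fun _ => True
  | s0 :: G1 => fun x0 => forall (r0 : env G' -> env G1), var_map r0 ->
      exists y : var (s0 :: G') t0, forall e, lookup y e = lookup x0 (e.1, r0 e.2)
  end x0.
suff h G0 t0 (x0 : var G0 t0) : P G0 t0 x0 by exact: (h _ _ x r hr).
case: G0 t0 / x0 => [G1 s0|G1 s0 t1 z] r0 h0.
  by exists (VarO _ _).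
by have [y hy] := h0 _ z; exists (VarS t1 y) => e /=.
Qed.

Lemma rename_term X G s (u : term X G s) G' (r : env G' -> env G) : var_map r ->
  exists u' : term X G' s, forall e, eval u' e = eval u (r e).
Proof.
elim: G s / u G' r => [G s x|G s f hf|G s t v IH|G s t v IHv w IHw] G' r hr.
- by have [y hy] := hr _ x; exists (Var X y).
- by exists (Const _ hf).
- have [v' hv] := IH _ _ (var_map_lift hr); exists (Lam v') => e /=.
  by apply: funext => x; rewrite hv.
- have [v' hv] := IHv _ _ hr; have [w' hw] := IHw _ _ hr.
  by exists (App v' w') => e /=; rewrite hv hw.
Qed.

Definition definable X G s (h : env G -> den s) : Prop :=
  exists u : term X G s, forall e, eval u e = h e.

Section Definable.

Variable X : functional_class.
Local Notation def := (definable X).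

Lemma def_closed G s (f : den s) : represented X f -> def (fun _ : env G => f).
Proof.
case=> u hu; have hr : @var_map [::] G (fun _ => tt) by move=> t x; inversion x.
have [u' hu'] := rename_term u hr.
by exists u' => e; rewrite hu'.
Qed.

Lemma def_weak G t s (h : env G -> den s) :
  def h -> def (fun e : env (t :: G) => h e.2).
Proof.
case=> u hu; have hr : @var_map G (t :: G) (fun e => e.2).
  by move=> t' x; exists (VarS t x).
by have [u' hu'] := rename_term u hr; exists u' => e; rewrite hu'.
Qed.

Lemma def_var0 G t : def (fun e : env (t :: G) => e.1).
Proof. by exists (Var X (VarO G t)). Qed.

Lemma def_app G s t (h : env G -> den (Arr s t)) (a : env G -> den s) :
  def h -> def a -> @definable X G t (fun e => h e (a e)).
Proof.
by move=> [u hu] [v hv]; exists (App u v) => e /=; rewrite hu hv.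
Qed.

Lemma def_lam G s t (h : env G -> den (Arr s t)) :
  @definable X (s :: G) t (fun e => h e.2 e.1) -> def h.
Proof.
by case=> u hu; exists (Lam u) => e /=; apply: funext => x; rewrite hu.
Qed.

Lemma represented_def s (f : den s) : @definable X [::] s (fun _ => f) -> represented X f.
Proof. by case=> u hu; exists u; rewrite hu. Qed.

Definition strdef G (h : env G -> str) : Prop := @definable X G Str h.

Lemma def_str1 G (f : str -> str) (a : env G -> str) :
  @represented X (Arr Str Str) f -> strdef a -> strdef (fun e => f (a e)).
Proof. by move=> /(@def_closed G) hf ha; apply: (def_app hf ha). Qed.

Lemma def_str2 G (f : str -> str -> str) (a b : env G -> str) :
  @represented X (Arr Str (Arr Str Str)) f -> strdef a -> strdef b ->
  strdef (fun e => f (a e) (b e)).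
Proof.
by move=> /(@def_closed G) hf ha hb; apply: (def_app (def_app hf ha) hb).
Qed.

Lemma def_str3 G (f : str -> str -> str -> str) (a b c : env G -> str) :
  @represented X (Arr Str (Arr Str (Arr Str Str))) f ->
  strdef a -> strdef b -> strdef c -> strdef (fun e => f (a e) (b e) (c e)).
Proof.
move=> /(@def_closed G) hf ha hb hc.
exact: (def_app (def_app (def_app hf ha) hb) hc).
Qed.

Lemma def_str4 G (f : str -> str -> str -> str -> str) (a b c d : env G -> str) :
  @represented X (Arr Str (Arr Str (Arr Str (Arr Str Str)))) f ->
  strdef a -> strdef b -> strdef c -> strdef d ->
  strdef (fun e => f (a e) (b e) (c e) (d e)).
Proof.
move=> /(@def_closed G) hf ha hb hc hd.
exact: (def_app (def_app (def_app (def_app hf ha) hb) hc) hd).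
Qed.

End Definable.

Lemma represented_const X s (f : den s) : X s f -> represented X f.
Proof. by move=> hf; exists (Const _ hf). Qed.

(** Every constant is replaced by a closed term that represents it, which can be weakened to any
    context. *)
Lemma represented_trans (X Y : functional_class) :
  (forall s (f : den s), X s f -> represented Y f) ->
  forall s (f : den s), represented X f -> represented Y f.
Proof.
move=> hXY; suff h G s (u : term X G s) : definable Y (eval u).
  by move=> s f [u <-]; have [u' hu'] := h _ _ u; exists u'; rewrite hu'.
elim: G s / u => [G s x|G s f hf|G s t v IH|G s t v IHv w IHw].
- by exists (Var Y x).
- exact: def_closed (hXY _ _ hf).
- by apply: def_lam; case: IH => u hu; exists u => -[x e]; rewrite hu.
- exact: (def_app IHv IHw).
Qed.

(** * Basic feasible functionals from the class MPT *)

Section FromMPT.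

Lemma rep_MPT F : MPT F -> @represented MPT_class (Arr (Arr Str Str) (Arr Str Str)) F.
Proof. by move=> hF; apply: represented_const; constructor. Qed.

Lemma rep_MPT_const g : MPT (fun _ => g) -> @represented MPT_class (Arr Str Str) g.
Proof.
move=> hg; apply: represented_def.
apply: (@def_app _ [::] (Arr Str Str) (Arr Str Str) (fun _ _ => g) (fun _ x => x)).
  exact: def_closed (rep_MPT hg).
by apply: (def_lam (def_var0 _ _ _)).
Qed.

Lemma rep_pair_str : @represented MPT_class (Arr Str (Arr Str Str)) pair_str.
Proof.
apply: represented_def; apply: def_lam; apply: def_lam.
apply: (@def_app _ _ Str Str (fun e : env [:: Str; Str] => ask_pair (fun _ => e.1))
  (fun e => e.2.1)); last exact: def_weak (def_var0 _ _ _).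
apply: (@def_app _ [:: Str; Str] (Arr Str Str) (Arr Str Str) (fun _ => ask_pair) (fun e _ => e.1)).
  exact: def_closed (rep_MPT MPT_ask_pair).
by apply: def_lam; apply: def_weak (def_var0 _ _ _).
Qed.

Fixpoint curry_packed (k : nat) (g : str -> str) (x : str) : den (str_fun k) :=
  match k return den (str_fun k) with
  | 0 => g x
  | k'.+1 => fun a => curry_packed k' g (pair_str a x)
  end.

Lemma def_curry_packed k g G (x : env G -> str) :
  @represented MPT_class (Arr Str Str) g -> strdef MPT_class x ->
  @definable MPT_class G (str_fun k) (fun e => curry_packed k g (x e)).
Proof.
move=> hg; elim: k G x => [|k IH] G x hx; first exact: def_str1.
apply: def_lam; apply: IH.
apply: (def_str2 rep_pair_str); [exact: def_var0 | exact: def_weak].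
Qed.

Lemma unpack_pair n a x : unpack n.+1 (pair_str a x) = rcons (unpack n x) a.
Proof. by rewrite /= unpair_pair. Qed.

(** The string [x] already carries [n] packed components; each further argument adds one to their
    right end. *)
Lemma curry_packedE k (f : den (str_fun k)) g n x :
  (forall x' (a : seq str), size a = k -> unpack (k + n) x' = unpack n x ++ a ->
    g x' = apply_list f a) ->
  curry_packed k g x = f.
Proof.
elim: k f n x => [|k IH] f n x h /=.
  by rewrite (h x [::]) // cats0.
apply: funext => b; apply: (IH _ n.+1) => x' a ha.
rewrite unpack_pair cat_rcons addnS -addSn => e.
by rewrite (h x' (b :: a)) //= ha.
Qed.

Lemma rep_FP s (f : den s) : FP_class f -> represented MPT_class f.
Proof.
case=> k {}f hf.
pose g x := apply_list f (unpack k.+1 x).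
have hg : @represented MPT_class (Arr Str Str) g.
  apply: rep_MPT_const; apply: (MPT_unpack hf) => a x e.
  by rewrite uncurry_strE /g e.
(* The packing needs some string to start from, and no closed term denotes one; the first argument
   itself is taken. *)
have -> : f = fun a => curry_packed k g (pair_str a a).
  apply/esym/funext => b; apply: (@curry_packedE k (f b) g 1) => x a ha.
  by rewrite addn1 unpack_pair => e; rewrite /g e.
apply: (@represented_def MPT_class (str_fun k.+1)).
apply: (@def_lam _ _ Str (str_fun k)); apply: def_curry_packed => //.
by apply: (def_str2 rep_pair_str); apply: def_var0.
Qed.

Lemma rep_limited_rec : @represented MPT_class
  (Arr (Arr Str (Arr Str Str)) (Arr Str (Arr Str (Arr Str Str)))) limited_rec.
Proof.
have [hent hrest] := MPT_entry_rest.
pose step (phi : str -> str -> str) q := phi (rest_of id q) (entry_of id q).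
(* The last [b] again only fills the place of a constant string. *)
have -> : limited_rec = fun phi a b c =>
    rec_op (step phi) (pair_str c (pair_str a (pair_str b b))).
  do 4![apply: funext => ?]; rewrite /rec_op; do !rewrite unpair_pair /=.
  congr limited_rec; do 2![apply: funext => ?].
  by rewrite /step /entry_of /rest_of unpair_pair /= revK.
have dent := rep_MPT_const (hent : MPT (fun _ => entry_of id)).
have drest := rep_MPT_const (hrest : MPT (fun _ => rest_of id)).
apply: represented_def; do 4!apply: def_lam.
pose G1 := [:: Arr Str (Arr Str Str)]; pose G2 := Str :: G1; pose G3 := Str :: G2.
pose G := Str :: G3.
have v0 : strdef MPT_class (fun e : env G => e.1) by exact: (def_var0 _ G3 Str).
have v1 : strdef MPT_class (fun e : env G => e.2.1) by exact: (@def_weak _ G3 Str Str _ (def_var0 _ G2 Str)).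
have v2 : strdef MPT_class (fun e : env G => e.2.2.1).
  exact: (@def_weak _ G3 Str Str _ (@def_weak _ G2 Str Str _ (def_var0 _ G1 Str))).
have v3 : @definable MPT_class G (Arr Str (Arr Str Str)) (fun e => e.2.2.2.1).
  apply: (@def_weak _ G3 Str _ (fun e => e.2.2.1)).
  apply: (@def_weak _ G2 Str _ (fun e => e.2.1)).
  exact: (@def_weak _ G1 Str _ (fun e => e.1) (def_var0 _ [::] _)).
apply: (@def_app _ G Str Str (fun e => rec_op (step e.2.2.2.1))
  (fun e => pair_str e.1 (pair_str e.2.2.1 (pair_str e.2.1 e.2.1)))); last first.
  exact: (def_str2 rep_pair_str v0 (def_str2 rep_pair_str v2 (def_str2 rep_pair_str v1 v1))).
apply: (@def_app _ G (Arr Str Str) (Arr Str Str) (fun _ => rec_op)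
  (fun e => step e.2.2.2.1)).
  exact: def_closed (rep_MPT MPT_rec_op).
apply: def_lam.
apply: (@def_app _ (Str :: G) Str Str (fun e => e.2.2.2.2.1 (rest_of id e.1))
  (fun e => entry_of id e.1)); last by apply: (def_str1 dent); apply: def_var0.
apply: (@def_app _ (Str :: G) Str (Arr Str Str) (fun e => e.2.2.2.2.1)
  (fun e => rest_of id e.1)); last by apply: (def_str1 drest); apply: def_var0.
exact: (@def_weak _ G Str _ _ v3).
Qed.

End FromMPT.

(** * Runs of machines in MPT *)

Lemma lookahead_rcons qs q : lookahead_revisions (rcons qs q) =
  lookahead_revisions qs + all (fun q' => size q' < size q) qs.
Proof.
rewrite /lookahead_revisions size_rcons -addn1 iotaD count_cat add0n /=.
rewrite nth_rcons ltnn eqxx -cats1 take_size_cat // addn0; congr (_ + _).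
apply: eq_in_count => i; rewrite mem_iota add0n => /andP[_ hi].
by rewrite nth_cat hi takel_cat // ltnW.
Qed.

Lemma lookahead_cat qs qs' : lookahead_revisions qs <= lookahead_revisions (qs ++ qs').
Proof.
elim/last_ind: qs' => [|qs' q IH]; first by rewrite cats0.
by rewrite -rcons_cat lookahead_rcons; apply: leq_trans IH (leq_addr _ _).
Qed.

Section Runs.

Variables (k : nat) (M : machine k).
Implicit Types (phi : str -> str) (a : k.-tuple str).

Lemma runS phi a n : run M phi a n.+1 = step phi (run M phi a n).
Proof. by []. Qed.

Lemma step_posed phi psi (c : config M) :
  (forall q, posed c = Some q -> psi q = phi q) -> step psi c = step phi c.
Proof.
rewrite /posed /step; case: halted => //; case: (ask c.1) => // q h.
by rewrite (h _ erefl).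
Qed.

Lemma run_eq_oracle phi psi a n :
  {in queries M phi a n, psi =1 phi} -> run M psi a n = run M phi a n.
Proof.
elim: n => [//|n IH]; rewrite queriesS => h.
rewrite !runS IH; last by move=> q hq; rewrite h // mem_cat hq.
apply: step_posed => q hq; apply: h.
by rewrite mem_cat hq /= inE eqxx orbT.
Qed.

Lemma max_length_leP phi a n m :
  reflect ((forall x, x \in (a : seq str) -> size x <= m) /\
           (forall q, q \in queries M phi a n -> size (phi q) <= m))
          (max_length M phi a n <= m).
Proof.
rewrite geq_max; apply: (iffP andP) => -[h1 h2].
  split=> [x hx|q hq]; first by move/bigmax_leqP_seq: h1; apply.
  by move/bigmax_leqP_seq: h2; apply.
by split; apply/bigmax_leqP_seq => x hx _; [apply: h1 | apply: h2].
Qed.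

Lemma max_length_mono phi a n n' : n <= n' ->
  max_length M phi a n <= max_length M phi a n'.
Proof.
move=> /(queries_prefix M phi a) [qs e]; apply/max_length_leP.
have /max_length_leP[h1 h2] := leqnn (max_length M phi a n').
by split=> // q hq; apply: h2; rewrite e mem_cat hq.
Qed.

(* Answering all the further queries by the empty string, one obtains a run that
   has to stop in time. *)
Lemma run_time_bound (B : nat -> nat) :
  {homo B : m n / m <= n} ->
  (forall phi a, exists2 n, runtime M phi a n & n <= B (max_length M phi a n)) ->
  forall phi a t, (forall i, i < t -> ~~ halted (run M phi a i)) ->
  t <= B (max_length M phi a t).
Proof.
move=> hB h phi a t ht.
pose psi q := if q \in queries M phi a t then phi q else [::].
have hpsi : {in queries M phi a t, psi =1 phi} by move=> q; rewrite /psi => ->.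
have [n [hn _] hle] := h psi a.
have tn : t <= n.
  rewrite leqNgt; apply/negP => lt; have := ht n lt.
  rewrite -(@run_eq_oracle phi psi a n) ?hn // => q hq; apply: hpsi.
  by have [qs ->] := queries_prefix M phi a (ltnW lt); rewrite mem_cat hq.
apply: leq_trans tn (leq_trans hle (hB _ _ _)); apply/max_length_leP.
have /max_length_leP[h1 h2] := leqnn (max_length M phi a t).
by split=> // q _; rewrite /psi; case: ifP => // /h2.
Qed.

Lemma size_blank_free_prefix r : size (blank_free_prefix r) <= size r.
Proof. by elim: r => //= -[b|] r IH //=. Qed.

(** A step extends a tape by at most one cell, except that an answer replaces the content of its
    tape, and then its length is covered by [max_length]. *)
Lemma size_run_tape phi a n t :
  size ((run M phi a n).2 t).2 <= max_length M phi a n + n.+1.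
Proof.
elim: n => [|n IH].
  rewrite /= ffunE; case: pickP => [i _|_] //=.
  have /max_length_leP[h1 _] := leqnn (max_length M phi a 0).
  by rewrite size_map; apply: leq_trans (h1 _ _) (leq_addr _ _); apply: mem_tnth.
have le := max_length_mono phi a (leqnSn n).
rewrite runS /step; case: ifP => hh; first by lia.
case e: (ask _) => [q|] /=; rewrite ffunE.
  case: eqP => _; last by lia.
  rewrite size_map.
  have /max_length_leP[_ h2] := leqnn (max_length M phi a n.+1).
  apply: leq_trans (h2 _ _) (leq_addr _ _).
  by rewrite queriesS mem_cat /posed hh e /= inE eqxx orbT.
case: (_ t) => w [] /=; rewrite ?size_behead; lia.
Qed.

Lemma size_posed phi a n q : posed (run M phi a n) = Some q ->
  size q <= max_length M phi a n + n.+1.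
Proof.
rewrite /posed; case: halted => //; case: (ask _) => // _ [<-].
exact: leq_trans (size_blank_free_prefix _) (size_run_tape _ _ _ _).
Qed.

Lemma size_queries phi a n : size (queries M phi a n) <= n.
Proof.
elim: n => [//|n IH]; rewrite queriesS size_cat.
by case: posed => [q|] /=; lia.
Qed.

Definition transcript (l : seq str) : str := flatten [seq pair_str s [::] | s <- l].

(** Replaying the true answers reproduces the run and consumes exactly their entries, whatever
    follows them. *)
Lemma sim_run phi a n N z : n <= N ->
  (forall i, i < n -> ~~ halted (run M phi a i)) ->
  sim N (initial M a, transcript (map phi (queries M phi a n)) ++ z) =
  sim (N - n) (run M phi a n, z).
Proof.
elim: n z => [|n IH] z hN hi; first by rewrite subn0.
rewrite queriesS map_cat /transcript map_cat flatten_cat -catA IH ?(ltnW hN) //; last first.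
  by move=> i hin; apply: hi; apply: ltnW.
rewrite -[N - n]/(N.+1 - n.+1) subSn //=.
have hh := hi n (leqnn _); rewrite /posed (negbTE hh).
rewrite /stuck /= (negbTE hh) /=.
case e: (ask _) => [q|] /=; last first.
  rewrite /sim_step /= e; congr (sim _ (_, _)).
  by apply: step_posed => q; rewrite /posed (negbTE hh) e.
set s := phi _; rewrite cats0 /pair_str -catA cat_cons /=.
(* Owing to its separator even an empty answer has a nonempty entry, so it is not mistaken for the
   end of the transcript. *)
have -> : (mark (rev s) ++ false :: z == [::]) = false by case: (mark _).
rewrite /sim_step /= e; have -> := unpair_pair s z.
by congr (sim _ (_, _)).
Qed.

End Runs.

(** * The class MPT from limited recursion *)

(** A string of length at most [L] is determined by its length and its padding to length [L], and
    [L.+1] is at most [2 ^ L]. *)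
Lemma size_uniq_strings L (l : seq str) :
  uniq l -> {in l, forall x, size x <= L} -> size l <= 2 ^ (2 * L).
Proof.
move=> ul hl.
pose pad (x : str) : L.-tuple bool := [tuple nth false x i | i < L].
pose f (x : str) : 'I_L.+1 * L.-tuple bool := (inord (size x), pad x).
have fI : {in l &, injective f}.
  move=> x y /hl hx /hl hy E.
  have := congr1 (fun p => val p.1) E; rewrite /= !inordK // => e.
  apply: (@eq_from_nth _ false) => // i hi.
  have hiL : i < L by apply: leq_trans hx.
  by have := congr1 (fun p => tnth p.2 (Ordinal hiL)) E; rewrite /= !tnth_mktuple.
rewrite -(size_map f) -(card_uniqP _) ?map_inj_in_uniq //.
apply: leq_trans (max_card _) _; rewrite card_prod card_ord card_tuple card_bool.
by rewrite mul2n -addnn expnD leq_mul2r ltn_expl ?orbT.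
Qed.

(* As long as no fixpoint of [g] is reached, the rank of the n-th iterate is at
   least n, so every application of the outer iteration doubles the number of
   steps; a chain of more than 2^(2L) strings of length at most [L] is impossible. *)
Lemma iter_fixpoint (g : str -> str) (rho : str -> nat) L
    (H := fun q => iter (rho q).+1 g q) (v := iter (2 * L + 1) H [::]) :
  (forall q, size q <= L -> size (g q) <= L) ->
  (forall q, size q <= L -> g q = q \/ rho q < rho (g q)) ->
  g v = v.
Proof.
move=> hs hr; set u := fun n => iter n g [::].
have us n : size (u n) <= L by elim: n => //= n IH; apply: hs.
have fixI n m : g (u n) = u n -> u (n + m) = u n.
  by move=> e; elim: m => [|m IH]; rewrite ?addn0 // addnS /u iterS -/(u _) IH e.
have fixH q m : g q = q -> iter m g q = q by move=> e; elim: m => //= m ->.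
have key j : g (iter j H [::]) = iter j H [::] \/
    exists n, [/\ iter j H [::] = u n, 2 ^ j <= n.+1 & g (u n) != u n].
  elim: j => [|j [e|[n [e hn hg]]]].
  - by case: (g [::] =P [::]) => [|/eqP ne]; [left | right; exists 0].
  - by left; rewrite iterS /H fixH.
  have rn m : m <= n -> m <= rho (u m).
    elim: m => // m IH hm; case: (hr (u m) (us m)) => [em|].
      by move: hg; rewrite -(subnKC (ltnW hm)) fixI // em eqxx.
    by apply: leq_ltn_trans; apply: IH; apply: ltnW.
  rewrite iterS e /H; set m := (rho (u n)).+1.
  have -> : iter m g (u n) = u (n + m) by rewrite /u addnC iterD.
  case: (g (u (n + m)) =P u (n + m)) => [|/eqP ne]; first by left.
  right; exists (n + m); split=> //.
  by rewrite expnS /m; have := rn n (leqnn _); lia.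
case: (key (2 * L + 1)) => // -[n [_ hn hg]].
have inc m : m < n -> rho (u m) < rho (u m.+1).
  move=> hm; case: (hr (u m) (us m)) => // em.
  by move: hg; rewrite -(subnKC (ltnW hm)) fixI // em eqxx.
have inc2 m m' : m < m' -> m' <= n -> rho (u m) < rho (u m').
  elim: m' => // m' IH; rewrite ltnS leq_eqVlt => /orP[/eqP ->|lt] hm'; first exact: inc.
  by apply: leq_trans (IH lt (ltnW hm')) (ltnW (inc _ hm')).
have ul : uniq [seq u i | i <- iota 0 n.+1].
  rewrite map_inj_in_uniq ?iota_uniq // => i j.
  rewrite !mem_iota add0n !ltnS /= => hi hj e.
  by case: (ltngtP i j) => // lt; [have := inc2 _ _ lt hj | have := inc2 _ _ lt hi];
    rewrite e ltnn.
have : n < 2 ^ (2 * L).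
  rewrite -[n.+1](size_iota 0) -(size_map u); apply: size_uniq_strings ul _.
  by move=> x /mapP[i _ ->].
move: hn; rewrite addn1 expnS; lia.
Qed.

Lemma limited_rec_iter g a b c :
  (forall v, size v <= size b -> size (g v) <= size b) -> size a <= size b ->
  limited_rec (fun _ => g) a b c = iter (size c) g a.
Proof.
move=> hg ha; have hi n : size (iter n g a) <= size b by elim: n => //= n; apply: hg.
elim/last_ind: c => [//|c i IH].
by rewrite limited_rec_rcons size_rcons IH take_oversize //; apply: (hi (_.+1)).
Qed.

(** One round of limited recursion is a truncation. *)
Definition take_str (l q : str) : str := limited_rec (fun _ _ => q) [::] l [:: true].

Lemma take_strE l q : take_str l q = take (size l) q.
Proof. by []. Qed.

Definition succ_str (w : str) : str := mul_add [:: true] [:: true] w.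
Definition add_str (w v : str) : str := mul_add [:: true] w v.

Fixpoint pow_str (C d : nat) (w : str) : str :=
  if d is d'.+1 then mul_add (pow_str C d' w) (succ_str w) [::] else nseq C true.

Lemma size_mul_add x y z : size (mul_add x y z) = size x * size y + size z.
Proof. by rewrite size_cat size_nseq. Qed.

Lemma size_pow_str C d w : size (pow_str C d w) = C * (size w).+1 ^ d.
Proof.
elim: d => [|d IH]; first by rewrite /= size_nseq muln1.
by rewrite /= !size_mul_add IH /= addn0 mul1n add1n -mulnA -expnSr.
Qed.

(** * The search for long answers *)

Section Search.

Variables (M : machine 1) (C d : nat) (phi : str -> str) (a : str).

(** The length of [w] stands for a known bound on the input and the answers. Its clock exceeds the
    resulting time bound, these lengths, and the length of any query that can be written in that
    time. *)
Definition clock (w : str) : str := add_str (pow_str C d w) (succ_str (succ_str w)).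

(** The query at which the simulation waits once the answers in [y] are used up; the empty string if
    it halts or the clock runs out first. *)
Definition query (c y : str) : str :=
  sim_str (fun q (e : bool) => [&& ~~ halting q, ask q != None & e]) (query_tape M) a c y.

Definition answer (c y : str) : str := sim_str (fun _ _ => true) (output_tape M) a c y.

Definition extend (c y : str) : str := add_entry c y (phi (query c y)).

(** The limit has length [|c| * (2 * |c| + 2)], enough for [|c|] entries of at most [2 * |c| + 1]
    symbols each. *)
Definition record (c x : str) : str :=
  limited_rec (fun _ => extend c) [::]
    (mul_add c (mul_add [:: true; true] c [:: true; true]) [::]) x.

Definition better (l q best : str) : str :=
  longer_answer (take_str l q) (phi (take_str l q)) best (phi best).

(** The run is replayed as far as answers of length [|w| + |phi q|] allow, and the query with the
    longest answer is kept among [q] and the queries met. The recursion covers the nonempty prefixes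
    of the counter, its initial value the empty one. *)
Definition improve (w q : str) : str :=
  let c := clock (add_str w (phi q)) in
  limited_rec (fun x => better (clock w) (query c (record c x)))
    (better (clock w) (query c [::]) q) (clock w) c.

Definition boost (w q : str) : str :=
  limited_rec (fun _ => improve w) q (clock w) (succ_str (phi q)).

(** The counter has length [2 * L + 1] for [L] the length of the clock, as required by
    [iter_fixpoint]. *)
Definition best_query (w : str) : str :=
  limited_rec (fun _ => boost w) [::] (clock w) (mul_add [:: true; true] (clock w) [:: true]).

Definition grow (w : str) : str := add_str w (phi (best_query w)).

Definition simulated (r : nat) : str :=
  let c := clock (iter r.+1 grow a) in answer c (record c c).

Local Notation B n := (C * n.+1 ^ d).
Local Notation run := (run M phi [tuple a]).
Local Notation queries := (queries M phi [tuple a]).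
Local Notation max_length := (max_length M phi [tuple a]).

Lemma size_clock w : size (clock w) = B (size w) + size w + 2.
Proof. by rewrite /clock /add_str /succ_str !size_mul_add size_pow_str /=; lia. Qed.

Lemma size_add_str w v : size (add_str w v) = size w + size v.
Proof. by rewrite size_mul_add mul1n. Qed.

Lemma better_spec l q best (v := better l q best) : size best <= size l ->
  [/\ size v <= size l, v = best \/ size (phi best) < size (phi v) &
      size q <= size l -> size (phi q) <= size (phi v)].
Proof.
rewrite {}/v /better take_strE /longer_answer => hb; case: ltnP => h; split.
- by rewrite size_take_min geq_minl.
- by right.
- by move=> hq; rewrite take_oversize.
- by [].
- by left.
- by move=> hq; move: h; rewrite take_oversize.
Qed.

Lemma improve_spec w q (c := clock (add_str w (phi q))) (v := improve w q) :
  size q <= size (clock w) ->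
  [/\ size v <= size (clock w), v = q \/ size (phi q) < size (phi v) &
      forall x, prefix x c -> let s := query c (record c x) in
        size s <= size (clock w) -> size (phi s) <= size (phi v)].
Proof.
move=> hq; rewrite {}/v /improve -/c; set l := clock w in hq *.
set psi := fun x => _; set v0 := better _ _ _.
have [h01 h02 h03] := better_spec (query c [::]) hq; rewrite -/v0 in h01 h02 h03.
(* The counter is generalised to [p], while the clock [c] inside the simulations stays fixed. *)
suff h p : let v := limited_rec psi v0 l p in
  [/\ size v <= size l, v = q \/ size (phi q) < size (phi v) &
      forall x, prefix x p -> let s := query c (record c x) in
        size s <= size l -> size (phi s) <= size (phi v)] by exact: h.
elim/last_ind: p => [|p i [h1 h2 h3]].
  by split=> // x; rewrite prefixs0 => /eqP ->.
rewrite limited_rec_rcons; set v := limited_rec psi v0 l p in h1 h2 h3 *.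
have [h4 h5 h6] := better_spec (query c (record c (rcons p i))) h1.
rewrite -[psi _ _]/(better l (query c (record c (rcons p i))) v).
move: (better _ _ _) h4 h5 h6 => v' h4 h5 h6; rewrite take_oversize //; split=> //.
  case: h5 => [->//|h5]; right; case: h2 => [<-//|h2]; exact: ltn_trans h2 h5.
move=> x /prefixP[y]; case/lastP: y => [|y b]; first by rewrite cats0 => <-; apply: h6.
rewrite -rcons_cat => /rcons_inj [ep _] s hs; have hx := h3 x; rewrite ep prefix_prefix in hx.
move: (hx isT hs) => {}hx.
by apply: leq_trans hx _; case: h5 => [->|/ltnW].
Qed.

Local Notation Y c i := (iter i (extend c) [::]).

Lemma size_extend c y : size (extend c y) <= size y + 2 * size c + 1.
Proof.
rewrite /= size_cat size_rev size_mark size_rev size_take_min.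
have := geq_minl (size c) (size (phi (query c y))); lia.
Qed.

Lemma recordE c x : size x <= size c -> record c x = Y c (size x).
Proof.
have szY i : size (Y c i) <= i * (2 * size c + 1).
  by elim: i => //= i IH; have := size_extend c (Y c i); rewrite /=; lia.
elim/last_ind: x => [//|x b IH]; rewrite size_rcons => hx.
rewrite /record limited_rec_rcons -/(record c x) IH ?(ltnW hx) // take_oversize //.
apply: leq_trans (szY (size x).+1) _; rewrite !size_mul_add /=; nia.
Qed.

(** Further rounds only append to the transcript in reading order, so recording too many answers
    does not disturb the earlier ones. *)
Lemma iter_extend_cat c j m : exists z, rev (Y c (j + m)) = rev (Y c j) ++ z.
Proof.
elim: m => [|m [z IH]]; first by exists [::]; rewrite addn0 cats0.
rewrite addnS iterS /extend /add_entry -cat_cons rev_cat IH -catA.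
by eexists.
Qed.

(** * Correctness of the search for a fixed oracle and input *)

Section FixedRun.

Hypothesis time_bound : forall t,
  (forall i, i < t -> ~~ halted (run i)) -> t <= B (max_length t).
Hypothesis halts : exists n, halted (run n).

Lemma query_run c y t q : (forall i, i < t -> ~~ halted (run i)) -> t < size c ->
  rev y = transcript (map phi (queries t)) -> posed (run t) = Some q -> query c y = q.
Proof.
move=> hi ht hy hq; rewrite /query /sim_str hy.
have := sim_run [::] (ltnW ht) hi; rewrite cats0 => ->.
rewrite -(subnSK ht) /=.
move: hq; rewrite /stuck /posed /=; case hh: (halted _) => //; case e: (ask _) => [q'|] //=.
by move=> [<-]; rewrite e /=; move: hh; rewrite /halted => ->.
Qed.

(** While time and answers stay within the clock, each round finds the next true query and records
    its answer without truncation. *)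
Lemma transcript_run c t : (forall i, i < t -> ~~ halted (run i)) -> t <= size c ->
  {in queries t, forall q, size (phi q) <= size c} ->
  rev (Y c (size (queries t))) = transcript (map phi (queries t)).
Proof.
elim: t => [//|t IH] hi ht; rewrite queriesS => hq.
have hi' i : i < t -> ~~ halted (run i) by move=> /ltnW; apply: hi.
have {}IH : rev (Y c (size (queries t))) = transcript (map phi (queries t)).
  by apply: IH => // [|q hqt]; [exact: ltnW | apply: hq; rewrite mem_cat hqt].
case ep: (posed _) hq => [q|] hq; last by rewrite !cats0.
rewrite size_cat addn1 iterS {1}/extend (query_run hi' ht IH ep) /add_entry.
rewrite take_oversize; last by apply: hq; rewrite mem_cat inE eqxx orbT.
rewrite rev_cons rev_cat revK IH map_cat /transcript map_cat flatten_cat -cats1 -catA.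
by rewrite /= cats0.
Qed.

Lemma answer_run c n : (forall i, i < n -> ~~ halted (run i)) -> halted (run n) ->
  n <= size c -> {in queries n, forall q, size (phi q) <= size c} ->
  answer c (record c c) = result M phi [tuple a] n.
Proof.
move=> hi hh hn hq; rewrite /answer /sim_str recordE //.
have le : size (queries n) <= size c by apply: leq_trans (size_queries _ _ _ _) hn.
have [z] := iter_extend_cat c (size (queries n)) (size c - size (queries n)).
rewrite subnKC // (transcript_run hi hn hq) => ->; rewrite sim_run //.
have stop m : sim m (run n, z) = (run n, z) by case: m => //= m; rewrite /stuck hh.
by rewrite stop.
Qed.

(** All strings in the nested recursions have length at most that of the clock, so no truncation
    occurs and they are plain iterations; [iter_fixpoint] applies with the length of the answer as
    rank. *)
Lemma best_query_fix w : improve w (best_query w) = best_query w /\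
  size (best_query w) <= size (clock w).
Proof.
set L := size (clock w).
have szI q : size q <= L -> size (improve w q) <= L by move=> /improve_spec [].
have szN n q : size q <= L -> size (iter n (improve w) q) <= L.
  by move=> hq; elim: n => //= n; apply: szI.
have bE q : size q <= L -> boost w q = iter (size (phi q)).+1 (improve w) q.
  by move=> hq; rewrite /boost limited_rec_iter.
have szB q : size q <= L -> size (boost w q) <= L by move=> hq; rewrite bE // szN.
have -> : best_query w = iter (2 * L + 1) (boost w) [::].
  by rewrite /best_query limited_rec_iter // size_mul_add.
have e n : iter n (boost w) [::] = iter n (fun q => iter (size (phi q)).+1 (improve w) q) [::] /\
    size (iter n (boost w) [::]) <= L.
  elim: n => [//|n [IH1 IH2]]; split; last by rewrite iterS szB.
  by rewrite iterS bE // IH1.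
split; last by case: (e (2 * L + 1)).
have [-> _] := e (2 * L + 1).
apply: (@iter_fixpoint (improve w) (fun q => size (phi q)) L) => // q.
by move=> /improve_spec [].
Qed.

(** The stage reached by the search: the bound [w] suffices up to a time [T] at which the run stops
    or its [r] first revisions are complete. [T.+1] includes the query posed at time [T], but not
    the length of its answer. *)
Definition covers (r : nat) (w : str) : Prop := exists T,
  [/\ T <= B (size w), max_length T <= size w &
      halted (run T) \/ r <= lookahead_revisions (queries T.+1)].

Lemma covers_grow r w : covers r w -> covers r.+1 (grow w).
Proof.
case=> T [hT hmT hr].
have [vfix vL] := best_query_fix w.
rewrite /grow; set v := best_query w in vfix vL *.
set u := add_str w (phi v); pose c := clock u.
have su : size u = size w + size (phi v) by rewrite size_add_str.
have sL := size_clock w; set L := size (clock w) in vL sL.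
have sc : size c = B (size u) + size u + 2 by apply: size_clock.
have Bmono m n : m <= n -> B m <= B n.
  by move=> h; rewrite leq_mul2l leq_expn2r ?orbT.
(* The new time is the first one at which the run halts or poses a query longer than [L]; all
   queries before it are short enough for the search. *)
pose stop t := halted (run t) || (if posed (run t) is Some q then L < size q else false).
have exstop : exists t, stop t by case: halts => n hn; exists n; rewrite /stop hn.
case: (ex_minnP exstop) => T' hT' minT'.
have nh t : t < T' -> ~~ halted (run t).
  by move=> lt; apply/negP => h; have := minT' t; rewrite /stop h leqNgt lt => /(_ isT).
have hshort t q : t < T' -> posed (run t) = Some q -> size q <= L.
  move=> lt hq; rewrite leqNgt; apply/negP => h.
  by have := minT' t; rewrite /stop hq h orbT leqNgt lt => /(_ isT).
have [_ _ closed] := improve_spec vL; rewrite vfix -/u -/c in closed.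
have amax : size a <= size w.
  have /max_length_leP[h _] := hmT; by apply: h; rewrite inE.
have bound t : t <= T' -> {in queries t, forall q, size (phi q) <= size (phi v)} ->
    max_length t <= size u /\ t <= B (size u).
  move=> le h; have hm : max_length t <= size u.
    apply/max_length_leP; split=> [x|q /h]; rewrite ?inE; last by lia.
    by move=> /eqP ->; apply: leq_trans amax _; lia.
  split=> //; apply: leq_trans (time_bound _) (Bmono _ _ hm).
  by move=> i lt; apply: nh; apply: leq_trans le.
(* By induction on time, no earlier answer beats that of [v]: the replay with clock [c] would meet
   its query, and [v] is a fixpoint of [improve]. *)
have small t : t <= T' -> {in queries t, forall q, size (phi q) <= size (phi v)}.
  elim: t => [//|t IH] lt; have {}IH := IH (ltnW lt).
  have [_ ht] := bound t (ltnW lt) IH.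
  rewrite queriesS => q; rewrite mem_cat => /orP[/IH //|].
  case ep: (posed _) => [q'|] //=; rewrite inE => /eqP ->.
  have nht i : i < t -> ~~ halted (run i) by move=> h; apply: nh; apply: ltn_trans lt.
  have tc : t < size c by lia.
  have jc : size (queries t) <= size c.
    by apply: leq_trans (size_queries _ _ _ _) (ltnW tc).
  have htr : rev (Y c (size (queries t))) = transcript (map phi (queries t)).
    by apply: transcript_run => // [|q0 /IH]; lia.
  (* For a prefix as long as the number of queries so far, [record] yields the true transcript, so
     the simulated query is the one posed at time [t]. *)
  have := closed _ (prefix_take c (size (queries t))); rewrite /=.
  rewrite recordE ?size_takel // (query_run nht tc htr ep); apply.
  exact: hshort ep.
have [hm' ht'] := bound _ (leqnn _) (small _ (leqnn _)).
exists T'; split=> //.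
case/orP: (hT'); first by left.
case ep: (posed _) => [q|] // hq; right.
(* Up to time [T] a query has length at most [|w| + B |w| + 1], which is less than [L]. The long
   query therefore comes later and is a further revision. *)
have TT' : T < T'.
  rewrite ltnNge; apply/negP => le.
  have := size_posed ep; have := max_length_mono M phi [tuple a] le.
  by have := Bmono _ _ (leqnn (size w)); lia.
case: hr => [hh|hr]; first by move: (nh _ TT'); rewrite hh.
rewrite queriesS ep /= cats1 lookahead_rcons.
have -> : all (fun q' => size q' < size q) (queries T').
  apply/allP => q' /=.
  have h t : t <= T' -> {in queries t, forall q, size q <= L}.
    elim: t => [//|t IH] lt; rewrite queriesS => q0; rewrite mem_cat.
    case/orP => [/IH|]; first by apply; apply: ltnW.
    by case e0: (posed _) => [q1|] //=; rewrite inE => /eqP ->; apply: hshort e0.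
  by move=> /(h _ (leqnn _)) hq'; apply: leq_ltn_trans hq.
rewrite addn1 ltnS; apply: leq_trans hr _.
by have [qs ->] := queries_prefix M phi [tuple a] TT'; apply: lookahead_cat.
Qed.

Lemma covers_iter r : covers r (iter r grow a).
Proof.
elim: r => [|r IH]; last exact: covers_grow.
exists 0; split=> //; last by right.
by apply/max_length_leP; split=> // x; rewrite inE => /eqP ->.
Qed.

(** Stage [r.+1] cannot have seen [r.+1] revisions, so it has seen the run halt; its clock is then
    long enough to replay the whole run. *)
Lemma simulatedE r F : (forall n, lookahead_revisions (queries n) <= r) ->
  (exists2 n, runtime M phi [tuple a] n & result M phi [tuple a] n = F) ->
  simulated r = F.
Proof.
move=> hr [n [hn hi] <-]; have [T [h1 h2 [hh|]]] := covers_iter r.+1; last first.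
  by move=> h; have := leq_trans h (hr _); rewrite ltnn.
have nT : n <= T by rewrite leqNgt; apply/negP => /hi; rewrite hh.
rewrite /simulated; apply: answer_run => //.
  by rewrite size_clock; lia.
move=> q hq; rewrite size_clock.
have /max_length_leP[_ h3] := h2.
have [qs e] := queries_prefix M phi [tuple a] nT.
have := h3 q; rewrite e mem_cat hq => /(_ isT); lia.
Qed.

End FixedRun.

End Search.

(** * Definability of the search by limited recursion *)

Section FromRecursion.

Variables (M : machine 1) (C d : nat).

Local Notation FPR := (class_union FP_class R_class).
Local Notation sdef := (strdef FPR).

Lemma rep_of_FP s (f : den s) : FP_class f -> represented FPR f.
Proof. by move=> hf; apply: represented_const; left. Qed.

Lemma def_limited_rec G (psi : env G -> str -> str -> str) (a b c : env G -> str) :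
  sdef (fun e : env [:: Str, Str & G] => psi e.2.2 e.2.1 e.1) ->
  sdef a -> sdef b -> sdef c ->
  sdef (fun e => limited_rec (psi e) (a e) (b e) (c e)).
Proof.
move=> hpsi ha hb hc.
have hR : @represented FPR (Arr (Arr Str (Arr Str Str))
    (Arr Str (Arr Str (Arr Str Str)))) limited_rec
  by apply: represented_const; right; constructor.
have hp : @definable FPR G (Arr Str (Arr Str Str)) psi by apply: def_lam; apply: def_lam.
exact: (def_app (def_app (def_app (def_app (def_closed G hR) hp) ha) hb) hc).
Qed.

Section Environment.

Variables (G : seq ty) (phi : env G -> str -> str) (a : env G -> str).
Hypothesis (dphi : @definable FPR G (Arr Str Str) phi) (da : sdef a).

Lemma def_phi x : sdef x -> sdef (fun e => phi e (x e)).
Proof. by move=> hx; apply: (def_app dphi hx). Qed.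

(** Constants come from constant unary functions, which have to be applied to some available string,
    here [a]. *)
Lemma def_cst s : sdef (fun _ : env G => s).
Proof. exact: (def_str1 (rep_of_FP (FP_const s)) da). Qed.

Lemma def_mul_add x y z : sdef x -> sdef y -> sdef z ->
  sdef (fun e : env G => mul_add (x e) (y e) (z e)).
Proof. exact: (def_str3 (rep_of_FP FP_mul_add)). Qed.

Lemma def_succ_str x : sdef x -> sdef (fun e : env G => succ_str (x e)).
Proof. by move=> hx; apply: (def_mul_add (def_cst _) (def_cst _) hx). Qed.

Lemma def_add_str x y : sdef x -> sdef y -> sdef (fun e : env G => add_str (x e) (y e)).
Proof. by move=> hx hy; apply: (def_mul_add (def_cst _) hx hy). Qed.

Lemma def_clock x : sdef x -> sdef (fun e : env G => clock C d (x e)).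
Proof.
move=> hx; apply: def_add_str; last by do 2!apply: def_succ_str.
elim: (d) => [|d' IH]; first exact: def_cst.
exact: (def_mul_add IH (def_succ_str hx) (def_cst _)).
Qed.

Lemma def_query c y : sdef c -> sdef y -> sdef (fun e => query M (a e) (c e) (y e)).
Proof. exact: (def_str3 (rep_of_FP (FP_sim_str _ _)) da). Qed.

Lemma def_answer c y : sdef c -> sdef y -> sdef (fun e => answer M (a e) (c e) (y e)).
Proof. exact: (def_str3 (rep_of_FP (FP_sim_str _ _)) da). Qed.

Lemma def_extend c y : sdef c -> sdef y ->
  sdef (fun e => extend M (phi e) (a e) (c e) (y e)).
Proof.
move=> hc hy.
exact: (def_str3 (rep_of_FP FP_add_entry) hc hy (def_phi (def_query hc hy))).
Qed.

Lemma def_better l q best : sdef l -> sdef q -> sdef best ->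
  sdef (fun e => better (phi e) (l e) (q e) (best e)).
Proof.
move=> hl hq hb.
have ht : sdef (fun e => take_str (l e) (q e)).
  apply: (@def_limited_rec G (fun e _ _ => q e)) => //; try exact: def_cst.
  exact: (def_weak Str (def_weak Str hq)).
exact: (def_str4 (rep_of_FP FP_longer_answer) ht (def_phi ht) hb (def_phi hb)).
Qed.

End Environment.

Lemma weak2 G t t' s (h : env G -> den s) : definable FPR h ->
  @definable FPR [:: t, t' & G] s (fun e => h e.2.2).
Proof. by move=> hh; apply: (def_weak t (def_weak t' hh)). Qed.

Lemma var0 G t : sdef (fun e : env [:: Str, t & G] => e.1).
Proof. exact: def_var0. Qed.

Lemma var1 G t : sdef (fun e : env [:: t, Str & G] => e.2.1).
Proof. exact: (def_weak t (def_var0 _ G Str)). Qed.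

Lemma def_record G (phi : env G -> str -> str) a c x :
  @definable FPR G (Arr Str Str) phi -> sdef a -> sdef c -> sdef x ->
  sdef (fun e => record M (phi e) (a e) (c e) (x e)).
Proof.
move=> hp ha hc hx; apply: (@def_limited_rec G (fun e _ y => extend M (phi e) (a e) (c e) y)).
- exact: (def_extend (weak2 Str Str hp) (weak2 Str Str ha) (weak2 Str Str hc) (var0 _ _)).
- exact: (def_cst ha).
- exact: (def_mul_add hc (def_mul_add (def_cst ha _) hc (def_cst ha _)) (def_cst ha _)).
- exact: hx.
Qed.

Lemma def_improve G (phi : env G -> str -> str) a w q :
  @definable FPR G (Arr Str Str) phi -> sdef a -> sdef w -> sdef q ->
  sdef (fun e => improve M C d (phi e) (a e) (w e) (q e)).
Proof.
move=> hp ha hw hq.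
have hl := def_clock ha hw.
have hc := def_clock ha (def_add_str ha hw (def_phi hp hq)).
apply: (@def_limited_rec G (fun e x best => better (phi e) (clock C d (w e))
   (query M (a e) (clock C d (add_str (w e) (phi e (q e))))
      (record M (phi e) (a e) (clock C d (add_str (w e) (phi e (q e)))) x)) best)).
- have hp2 := weak2 Str Str hp; have ha2 := weak2 Str Str ha; have hc2 := weak2 Str Str hc.
  apply: (def_better hp2 ha2 (weak2 Str Str hl) _ (var0 _ _)).
  exact: (def_query ha2 hc2 (def_record hp2 ha2 hc2 (var1 _ _))).
- exact: (def_better hp ha hl (def_query ha hc (def_cst ha _)) hq).
- exact: hl.
- exact: hc.
Qed.

Lemma def_boost G (phi : env G -> str -> str) a w q :
  @definable FPR G (Arr Str Str) phi -> sdef a -> sdef w -> sdef q ->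
  sdef (fun e => boost M C d (phi e) (a e) (w e) (q e)).
Proof.
move=> hp ha hw hq.
apply: (@def_limited_rec G (fun e _ v => improve M C d (phi e) (a e) (w e) v)) => //.
- exact: (def_improve (weak2 Str Str hp) (weak2 Str Str ha) (weak2 Str Str hw) (var0 _ _)).
- exact: (def_clock ha hw).
- exact: (def_succ_str ha (def_phi hp hq)).
Qed.

Lemma def_grow G (phi : env G -> str -> str) a w :
  @definable FPR G (Arr Str Str) phi -> sdef a -> sdef w ->
  sdef (fun e => grow M C d (phi e) (a e) (w e)).
Proof.
move=> hp ha hw; apply: (def_add_str ha hw); apply: (def_phi hp).
apply: (@def_limited_rec G (fun e _ v => boost M C d (phi e) (a e) (w e) v)).
- exact: (def_boost (weak2 Str Str hp) (weak2 Str Str ha) (weak2 Str Str hw) (var0 _ _)).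
- exact: (def_cst ha).
- exact: (def_clock ha hw).
- exact: (def_mul_add (def_cst ha _) (def_clock ha hw) (def_cst ha _)).
Qed.

(** The number of revisions is fixed for the machine, so the iteration of [grow] is unfolded into
    the term and needs no recursor. *)
Lemma rep_simulated r : @represented FPR (Arr (Arr Str Str) (Arr Str Str))
  (fun phi a => simulated M C d phi a r).
Proof.
apply: represented_def; do 2!apply: def_lam.
pose G := [:: Str; Arr Str Str].
have hp : @definable FPR G (Arr Str Str) (fun e => e.2.1).
  exact: (def_weak Str (def_var0 _ [::] (Arr Str Str))).
have ha : sdef (fun e : env G => e.1) by apply: def_var0.
have hw : sdef (fun e : env G => iter r.+1 (grow M C d e.2.1 e.1) e.1).
  by elim: r.+1 => [//|n IH]; apply: (def_grow hp ha IH).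
have hc := def_clock ha hw.
exact: (def_answer ha hc (def_record hp ha hc hc)).
Qed.

End FromRecursion.

Lemma rep_of_MPT F : MPT F -> @represented (class_union FP_class R_class)
  (Arr (Arr Str Str) (Arr Str Str)) F.
Proof.
case=> M [hM [p hp] [r hr]]; have [C [d hC]] := bound_of_poly p.
suff -> : F = fun phi a => simulated M C d phi a r by apply: rep_simulated.
apply: funext => phi; apply: funext => a; apply/esym/simulatedE => //.
- move=> t; apply: (@run_time_bound _ M (fun n => C * n.+1 ^ d)).
    by move=> m n le; rewrite leq_mul2l leq_expn2r ?orbT.
  by move=> psi b; have [n h1 h2] := hp psi b; exists n => //; apply: leq_trans h2 (hC _).
- by have [n [h _] _] := hM phi [tuple a]; exists n.
Qed.

Theorem mainTheorem7 : forall (s : ty) (f : den s),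
  @represented MPT_class s f <-> @BFF s f.
Proof.
(* In both directions it is enough to represent the constants. *)
move=> s f; split; apply: represented_trans => {f}s f.
  by case=> F; apply: rep_of_MPT.
case; first exact: rep_FP.
by case; apply: rep_limited_rec.
Qed.
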